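(* Let $F:\mathbb{R}^d\to\mathbb{R}$ be $L$-smooth (differentiable with $\|\nabla F(x)-\nabla F(y)\|\le L\|x-y\|$ for all $x,y$), with $|F(w)|\le M$ for all $w$, and suppose $\|\nabla f(w;z)\|\le G$ for all $w\in\mathbb{R}^d$, $z\in\Omega$. Then the iterates of the (unconstrained) MAG algorithm with $\alpha=1$ satisfy \[ \mathbb{E}\Big[\frac1T\sum_{t=1}^T\|\nabla F(w_t)\|^2\Big]\le\tilde{\mathcal{O}}\Big((M+L+G)\,G\sqrt{\tfrac{\tau_{\mathrm{mix}}}{T}}\Big). \]
   Context: Let $\Omega$ be a finite set and $(z_k)_{k\ge1}$ an ergodic time-homogeneous Markov chain on $\Omega$ (arbitrary initial distribution) with stationary distribution $\mu$. For probability measures $P,Q$ on $\Omega$, $\|P-Q\|_{TV}=\sup_A|P(A)-Q(A)|$; $P^s(z,\cdot)$ is the law of $z_{s+1}$ given $z_1=z$, $d_{\mathrm{mix}}(s)=\sup_{z}\|P^s(z,\cdot)-\mu\|_{TV}$, and $\tau_{\mathrm{mix}}=\inf\{s:d_{\mathrm{mix}}(s)\le1/4\}$. $f(\cdot;z)$ is differentiable for each $z$ and $F(w)=\mathbb{E}_{z\sim\mu}[f(w;z)]$. MAG algorithm (unconstrained, inputs $T\in\mathbb{N}$, $\alpha>0$, $w_1\in\mathbb{R}^d$): for $t=1,\dots,T$: draw $J_t$ with $\mathbb{P}(J_t=j)=2^{-j}$, $j\ge1$, independently of the chain and previous draws; set $N_t=2^{J_t}$; iteration $t$ uses the next $N_t$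 chain samples $z_t^{(i)}=z_{S_{t-1}+i}$, $S_{t-1}=N_1+\dots+N_{t-1}$; for $j\ge0$, $g_t^j=2^{-j}\sum_{i=1}^{2^j}\nabla f(w_t;z_t^{(i)})$; $g_t=g_t^0+2^{J_t}(g_t^{J_t}-g_t^{J_t-1})$ if $2^{J_t}\le T$, else $g_t=g_t^0$; $\eta_t=\alpha/\sqrt{\sum_{k=1}^t\|g_k\|^2}$ and $w_{t+1}=w_t-\eta_tg_t$. The notation $\tilde{\mathcal{O}}(X)$ means a quantity bounded by $c\cdot X$ times a factor polylogarithmic in $T$ and $\tau_{\mathrm{mix}}$, with $c$ an absolute constant. *)

(* Defs.v *)
From HB Require Import structures.
From mathcomp Require Import all_boot all_order all_algebra.
From mathcomp Require Import all_classical all_reals all_analysis.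
Set Implicit Arguments. Unset Strict Implicit. Unset Printing Implicit Defensive.
Import Order.TTheory GRing.Theory Num.Theory.
Import numFieldNormedType.Exports.
Local Open Scope ring_scope.

Section Defs.
Variable R : realType.

Definition enorm d (v : 'rV[R]_d) : R := Num.sqrt (\sum_(i < d) (v ord0 i) ^+ 2).

Definition grad d (h : 'rV[R]_d -> R) (w : 'rV[R]_d) : 'rV[R]_d :=
  \row_(i < d) derive h w (delta_mx ord0 i : 'rV[R]_d).

Variable Om : finType.

Definition stochastic (P : Om -> Om -> R) :=
  (forall x y, 0 <= P x y) /\ (forall x, \sum_y P x y = 1).

Definition prob_distr (nu : Om -> R) :=
  (forall x, 0 <= nu x) /\ \sum_x nu x = 1.

Fixpoint Ppow (P : Om -> Om -> R) (s : nat) : Om -> Om -> R :=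
  match s with
  | 0 => fun x y => if x == y then 1 else 0
  | s'.+1 => fun x y => \sum_u Ppow P s' x u * P u y
  end.

Definition irreducible (P : Om -> Om -> R) :=
  forall x y, exists n, 0 < Ppow P n x y.

Definition aperiodic (P : Om -> Om -> R) :=
  forall x (dv : nat), (0 < dv)%N ->
    (forall n, (0 < n)%N -> 0 < Ppow P n x x -> (dv %| n)%N) -> dv = 1%N.

Definition ergodic (P : Om -> Om -> R) := irreducible P /\ aperiodic P.

Definition stationary (P : Om -> Om -> R) (mu : Om -> R) :=
  prob_distr mu /\ forall y, \sum_x mu x * P x y = mu y.

Definition tv (p q : Om -> R) : R :=
  \big[Num.max/0]_(A : {set Om}) `|\sum_(x in A) (p x - q x)|.

Definition dmix (P : Om -> Om -> R) (mu : Om -> R) (s : nat) : R :=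
  \big[Num.max/0]_(z : Om) tv (Ppow P s z) mu.

Definition is_tau_mix (P : Om -> Om -> R) (mu : Om -> R) (tau : nat) :=
  dmix P mu tau <= 4^-1 /\ forall s, (s < tau)%N -> 4^-1 < dmix P mu s.

(* probability that z_1 = xs 0, ..., z_n = xs (n-1) *)
Definition chain_prob (nu : Om -> R) (P : Om -> Om -> R) (n : nat) (xs : nat -> Om) : R :=
  match n with
  | 0 => 1
  | n'.+1 => nu (xs 0%N) * \prod_(i < n') P (xs i) (xs i.+1)
  end.

Definition geom_weight (j : nat) : R := if (0 < j)%N then (2 ^+ j)^-1 else 0.

(* ---------- the MAG algorithm (deterministic part) ----------
   js t = J_t (t >= 1), zs k = z_k (k >= 1). *)
Variable d : nat.
Variable f : Om -> 'rV[R]_d -> R.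

Definition mag_S (js : nat -> nat) (t : nat) : nat := \sum_(1 <= k < t.+1) 2 ^ js k.

Definition mag_gj (js : nat -> nat) (zs : nat -> Om) (t j : nat) (w : 'rV[R]_d) : 'rV[R]_d :=
  (2 ^+ j)^-1 *: \sum_(1 <= i < (2 ^ j).+1) grad (f (zs (mag_S js t.-1 + i)%N)) w.

Definition mag_g (T : nat) (js : nat -> nat) (zs : nat -> Om) (t : nat) (w : 'rV[R]_d) : 'rV[R]_d :=
  if (2 ^ js t <= T)%N then
    mag_gj js zs t 0 w + (2 ^+ js t) *: (mag_gj js zs t (js t) w - mag_gj js zs t (js t).-1 w)
  else mag_gj js zs t 0 w.

(* mag_state T alpha w1 js zs n = (w_{n+1}, sum_{k<=n} ||g_k||^2) *)
Fixpoint mag_state (T : nat) (alpha : R) (w1 : 'rV[R]_d) (js : nat -> nat) (zs : nat -> Om)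
  (n : nat) : 'rV[R]_d * R :=
  match n with
  | 0 => (w1, 0)
  | n'.+1 =>
      let: (w, a) := mag_state T alpha w1 js zs n' in
      let g := mag_g T js zs n w in
      let a' := a + enorm g ^+ 2 in
      (w - (alpha / Num.sqrt a') *: g, a')
  end.

(* iterate w_t, t >= 1 *)
Definition mag_iter T alpha w1 js zs (t : nat) : 'rV[R]_d :=
  (mag_state T alpha w1 js zs t.-1).1.

End Defs.

(* Main.v *)
(**
  Write [a_t = sum_(k <= t) ||g_k||^2], so that the step size is [1 / sqrt a_t].
  Multiplying the descent inequality of the [L]-smooth [F] by [sqrt a_t] and summing by
  parts gives, on every path, [sum_t <g_t, grad F w_t> <= (2 M + L) sqrt a_T].

  It remains to control the conditional first and second moments of [g_t].  The law of [J_t]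
  makes the expectation telescope, so [g_t] is as biased as the average of [2^jmax ~ T]
  consecutive samples, i.e. by [O(G tau / T)], and [E||g_t||^2 = O(G^2 tau log T)].  Both
  bounds rest on [sum_s rho s <= 4 tau], where [rho s] is the worst l1-distance of [P^s x]
  to [mu]: [rho] is submultiplicative and at most [1/2] at time [tau].  Jensen's inequality
  bounds [E sqrt a_T].

  Levels [J_t] are unbounded.  For a cutoff [K], the event that some [J_t] exceeds [K] has
  vanishing probability, and outside of it the integrand is dominated by a simple function whose
  integral is at most a finite nested sum in which [J_t] is replaced by [min J_t K].  This
  truncation keeps the telescoping exact as soon as [T < 2^K].
*)
Require Import Defs.
From HB Require Import structures.
From mathcomp Require Import all_boot all_order all_algebra.
From mathcomp Require Import all_classical all_reals all_analysis.
From mathcomp Require Import measurable_realfun.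
From mathcomp Require Import ring lra.
Import Order.TTheory GRing.Theory Num.Theory.
Import numFieldNormedType.Exports.
Local Open Scope ring_scope.
Set Implicit Arguments. Unset Strict Implicit. Unset Printing Implicit Defensive.

(** * Euclidean inner product and its elementary inequalities *)

Section InnerProduct.
Variables (R : realType) (d : nat).
Implicit Types u v w : 'rV[R]_d.

Definition dot u v : R := \sum_i u ord0 i * v ord0 i.

Lemma dotC u v : dot u v = dot v u.
Proof. by apply: eq_bigr => i _; rewrite mulrC. Qed.

Lemma dotDl u v w : dot (u + v) w = dot u w + dot v w.
Proof. by rewrite -big_split; apply: eq_bigr => i _; rewrite mxE mulrDl. Qed.

Lemma dotZl c u w : dot (c *: u) w = c * dot u w.
Proof. by rewrite mulr_sumr; apply: eq_bigr => i _; rewrite mxE mulrA. Qed.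

Lemma dot0l w : dot 0 w = 0.
Proof. by rewrite -(scale0r w) dotZl mul0r. Qed.

Lemma dotNl u w : dot (- u) w = - dot u w.
Proof. by rewrite -scaleN1r dotZl mulN1r. Qed.

Lemma dotBl u v w : dot (u - v) w = dot u w - dot v w.
Proof. by rewrite dotDl dotNl. Qed.

Lemma dotDr u v w : dot w (u + v) = dot w u + dot w v.
Proof. by rewrite dotC dotDl !(dotC w). Qed.

Lemma dotZr c u w : dot w (c *: u) = c * dot w u.
Proof. by rewrite dotC dotZl dotC. Qed.

Lemma dotBr u v w : dot w (u - v) = dot w u - dot w v.
Proof. by rewrite dotC dotBl !(dotC w). Qed.

Lemma dot_suml (I : Type) (r : seq I) (u : I -> 'rV[R]_d) w :
  dot (\sum_(i <- r) u i) w = \sum_(i <- r) dot (u i) w.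
Proof. by elim/big_ind2: _ => [|_ x _ y <- <-|//]; rewrite ?dot0l ?dotDl. Qed.

Lemma dotvv_ge0 u : 0 <= dot u u.
Proof. by apply: sumr_ge0 => i _; rewrite -expr2 sqr_ge0. Qed.

Lemma enorm_sqr u : enorm u ^+ 2 = dot u u.
Proof.
have E : \sum_(i < d) u ord0 i ^+ 2 = dot u u by apply: eq_bigr => i _; rewrite expr2.
by rewrite /enorm E sqr_sqrtr // dotvv_ge0.
Qed.

Lemma enorm_ge0 u : 0 <= enorm u. Proof. exact: sqrtr_ge0. Qed.

Lemma dotvv_le u (B : R) : enorm u <= B -> dot u u <= B ^+ 2.
Proof. by move=> uB; rewrite -enorm_sqr lerXn2r ?nnegrE ?(le_trans (enorm_ge0 u)) ?enorm_ge0. Qed.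

Lemma enormZ c u : enorm (c *: u) = `|c| * enorm u.
Proof.
apply/eqP; rewrite -(@eqrXn2 _ 2) ?mulr_ge0 ?enorm_ge0 // exprMn !enorm_sqr.
by rewrite dotZl dotZr mulrA -expr2 real_normK ?num_real.
Qed.

Lemma dotvv_eq0 u : dot u u = 0 -> u = 0.
Proof.
move=> /eqP; rewrite psumr_eq0 => [/allP h|i _]; last by rewrite -expr2 sqr_ge0.
apply/rowP => i; have := h i (mem_index_enum i).
by rewrite -expr2 sqrf_eq0 mxE => /eqP.
Qed.

(** Cauchy-Schwarz: the squared norm of [dot v v *: u - dot u v *: v] is [dot v v] times
    [dot u u * dot v v - dot u v ^+ 2], so the latter is nonnegative. *)
Lemma dot_le u v : dot u v <= enorm u * enorm v.
Proof.
have [v0|v0] := eqVneq (dot v v) 0.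
  by rewrite (dotvv_eq0 v0) dotC dot0l mulr_ge0 ?enorm_ge0.
have vp : 0 < dot v v by rewrite lt_def v0 dotvv_ge0.
have h : (dot u v) ^+ 2 <= dot u u * dot v v.
  rewrite -subr_ge0 -(pmulr_rge0 _ vp).
  have := dotvv_ge0 (dot v v *: u - dot u v *: v).
  rewrite !dotBl !dotBr !dotZl !dotZr (dotC v u) => h.
  by apply: le_trans h _; rewrite le_eqVlt; apply/orP; left; apply/eqP; ring.
rewrite (le_trans (ler_norm _)) // -(@ler_pXn2r _ 2) ?nnegrE ?mulr_ge0 ?enorm_ge0 //.
by rewrite real_normK ?num_real // exprMn !enorm_sqr.
Qed.

Lemma dot_norm_le u v (B : R) :
  dot u u <= B -> dot v v <= B -> `|dot u v| <= B.
Proof.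
move=> uB vB; rewrite ler_norml; have := dotvv_ge0 (u + v); have := dotvv_ge0 (u - v).
rewrite dotBl !dotBr dotDl !dotDr (dotC v u) => h1 h2; apply/andP; split; lra.
Qed.

Lemma dotvvD_le u v : dot (u + v) (u + v) <= 2 * dot u u + 2 * dot v v.
Proof.
have := dotvv_ge0 (u - v).
rewrite dotBl !dotBr dotDl !dotDr (dotC v u); lra.
Qed.

Lemma dotvvB_le u v : dot (u - v) (u - v) <= 2 * dot u u + 2 * dot v v.
Proof.
have := dotvvD_le u (- v); suff -> : dot (- v) (- v) = dot v v by [].
by rewrite dotNl dotC dotNl opprK.
Qed.

End InnerProduct.

(** * Decay of the l1-distance to stationarity *)

Section Mixing.
Variables (R : realType) (Om : finType) (P : Om -> Om -> R) (mu : Om -> R).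
Hypothesis P_stoch : stochastic P.
Hypothesis mu_stat : stationary P mu.

Definition l1dist (s : nat) (x : Om) : R := \sum_y `|Ppow P s x y - mu y|.

Definition rho (s : nat) : R := \big[Num.max/0]_x l1dist s x.

Lemma l1dist_le_rho s x : l1dist s x <= rho s.
Proof. exact: le_bigmax. Qed.

Lemma rho_ge0 s : 0 <= rho s.
Proof. exact: bigmax_ge_id. Qed.

Lemma rho_le s B : 0 <= B -> (forall x, l1dist s x <= B) -> rho s <= B.
Proof. by move=> B0 h; apply: bigmax_le. Qed.

Lemma Ppow_sum1 s x : \sum_y Ppow P s x y = 1.
Proof.
elim: s x => [|s IH] x /=.
  by rewrite (bigD1 x) //= eqxx big1 ?addr0 // => y /negPf; rewrite eq_sym => ->.
rewrite exchange_big /= -[RHS](IH x); apply: eq_bigr => u _.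
by rewrite -mulr_sumr (P_stoch.2 u) mulr1.
Qed.

Lemma Ppow_ge0 s x y : 0 <= Ppow P s x y.
Proof.
elim: s x y => [|s IH] x y /=; first by case: ifP.
by apply: sumr_ge0 => u _; rewrite mulr_ge0 ?P_stoch.1.
Qed.

Lemma Ppow_add s t x y : Ppow P (s + t) x y = \sum_u Ppow P s x u * Ppow P t u y.
Proof.
elim: t y => [|t IH] y /=.
  rewrite addn0 (bigD1 y) //= eqxx mulr1 big1 ?addr0 // => u /negPf ->.
  by rewrite mulr0.
rewrite addnS /=; under eq_bigr do rewrite IH mulr_suml.
rewrite exchange_big; apply: eq_bigr => u _ /=; rewrite mulr_sumr.
by apply: eq_bigr => v _; rewrite mulrA.
Qed.

Lemma mu_Ppow t y : \sum_x mu x * Ppow P t x y = mu y.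
Proof.
elim: t y => [|t IH] y /=.
  rewrite (bigD1 y) //= eqxx mulr1 big1 ?addr0 // => u /negPf ->.
  by rewrite mulr0.
under eq_bigr do rewrite mulr_sumr.
rewrite exchange_big /= -[RHS](mu_stat.2 y); apply: eq_bigr => u _ /=.
by rewrite -[mu u in RHS]IH mulr_suml; apply: eq_bigr => v _; rewrite mulrA.
Qed.

(* With [Pi] the rank-one matrix of rows [mu]: (P^s - Pi)(P^t - Pi) = P^(s+t) - Pi. *)
Lemma rho_add s t : rho (s + t) <= rho s * rho t.
Proof.
apply: rho_le => [|x]; first by rewrite mulr_ge0 ?rho_ge0.
have E y : Ppow P (s + t) x y - mu y
         = \sum_u (Ppow P s x u - mu u) * (Ppow P t u y - mu y).
  rewrite Ppow_add; under [RHS]eq_bigr do rewrite mulrBr !mulrBl.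
  rewrite !sumrB -!mulr_suml mu_Ppow Ppow_sum1 mu_stat.1.2; ring.
apply: (@le_trans _ _ (\sum_y \sum_u `|Ppow P s x u - mu u| * `|Ppow P t u y - mu y|)).
  apply: ler_sum => y _; rewrite E (le_trans (ler_norm_sum _ _ _)) //.
  by apply: ler_sum => u _; rewrite normrM.
rewrite exchange_big /= (@le_trans _ _ (\sum_u `|Ppow P s x u - mu u| * rho t)) //.
  by apply: ler_sum => u _; rewrite -mulr_sumr ler_wpM2l // l1dist_le_rho.
by rewrite -mulr_suml ler_wpM2r ?rho_ge0 ?l1dist_le_rho.
Qed.

Lemma rho_le2 s : rho s <= 2.
Proof.
apply: rho_le => // x; apply: (@le_trans _ _ (\sum_y (Ppow P s x y + mu y))).
  apply: ler_sum => y _; rewrite (le_trans (ler_normB _ _)) //.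
  by rewrite !ger0_norm ?Ppow_ge0 ?mu_stat.1.1.
by rewrite big_split /= Ppow_sum1 mu_stat.1.2.
Qed.

(** Right multiplication by [P] contracts the l1-norm and fixes [mu]. *)
Lemma rhoS s : rho s.+1 <= rho s.
Proof.
apply: rho_le => [|x]; first exact: rho_ge0.
apply: le_trans (l1dist_le_rho s x); rewrite /l1dist /=.
apply: (@le_trans _ _ (\sum_y \sum_u `|Ppow P s x u - mu u| * P u y)).
  apply: ler_sum => y _; rewrite -{1}(mu_stat.2 y) -sumrB (le_trans (ler_norm_sum _ _ _)) //.
  by apply: ler_sum => u _; rewrite -mulrBl normrM (ger0_norm (P_stoch.1 u y)).
rewrite exchange_big /=; apply: ler_sum => u _.
by rewrite -mulr_sumr (P_stoch.2 u) mulr1.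
Qed.

Lemma rho_nincr s t : (s <= t)%N -> rho t <= rho s.
Proof.
move=> /subnK <-; elim: (t - s)%N => [|n IH]; first by rewrite add0n.
by rewrite addSn (le_trans (rhoS _)).
Qed.

(** Splitting by the sign of [p y - q y] leaves two sums over events, each tested by [tv]. *)
Lemma l1_le_tv (p q : Om -> R) : \sum_y `|p y - q y| <= 2 * tv p q.
Proof.
have h (A : {set Om}) : `|\sum_(x in A) (p x - q x)| <= tv p q by exact: le_bigmax.
rewrite (bigID (mem [set y | 0 <= p y - q y])) /= mulr_natl mulr2n.
apply: lerD.
  apply: le_trans (h [set y | 0 <= p y - q y]); apply: le_trans (ler_norm _).
  by apply: ler_sum => y; rewrite inE => /ger0_norm ->.
apply: le_trans (h (~: [set y | 0 <= p y - q y])); rewrite -normrN -sumrN.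
apply: le_trans (ler_norm _); rewrite le_eqVlt; apply/orP; left; apply/eqP.
apply: eq_big => y; first by rewrite !inE.
by rewrite !inE -ltNge => /ltr0_norm.
Qed.

(** A total variation of 1/4 is at most 1/2 in l1. The maximum with 1 covers [tau = 0] and lets
    later estimates absorb constants. *)
Lemma rho_tau tau : is_tau_mix P mu tau -> rho (maxn 1 tau) <= 2^-1.
Proof.
move=> [h _]; apply: (le_trans (rho_nincr (leq_maxr 1 tau))).
apply: rho_le => // x; apply: le_trans (l1_le_tv _ _) _.
have : tv (Ppow P tau x) mu <= dmix P mu tau by exact: le_bigmax.
lra.
Qed.

Lemma sum_rho_le2 N : \sum_(s < N) rho s <= 2 * N%:R.
Proof.
have -> : 2 * N%:R = \sum_(s < N) 2 :> R by rewrite sumr_const card_ord mulr_natr.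
apply: ler_sum => s _. apply: rho_le2.
Qed.

(** With [t = maxn 1 tau], the first [t] terms add up to at most [2 t], and
    [rho (t + s) <= rho s / 2]. So the sum [S] obeys [S <= 2 t + S / 2]. *)
Lemma sum_rho_tau tau N : is_tau_mix P mu tau ->
  \sum_(s < N) rho s <= 4 * (maxn 1 tau)%:R.
Proof.
move=> /rho_tau; set t := maxn 1 tau => ht.
have mono n m : (n <= m)%N -> \sum_(s < n) rho s <= \sum_(s < m) rho s.
  move=> nm; rewrite -(subnKC nm) big_split_ord /= lerDl.
  by apply: sumr_ge0 => *; exact: rho_ge0.
have h1 : \sum_(s < N) rho s <= \sum_(s < t + N) rho s by apply: mono; rewrite leq_addl.
rewrite big_split_ord /= in h1.
have h2 := sum_rho_le2 t.
have h3 : \sum_(s < N) rho (t + s) <= 2^-1 * \sum_(s < N) rho s.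
  rewrite mulr_sumr; apply: ler_sum => s _; apply: le_trans (rho_add _ _) _.
  by rewrite ler_wpM2r ?rho_ge0.
lra.
Qed.

(** As [phi] has mean zero under [mu], the law [Ppow P s x] may be replaced by its difference with
    [mu]. *)
Lemma Ppow_mean0_le (q phi : Om -> R) (B : R) s : prob_distr q ->
  (forall x, `|phi x| <= B) -> \sum_x mu x * phi x = 0 ->
  `|\sum_x q x * \sum_y Ppow P s x y * phi y| <= B * rho s.
Proof.
move=> [q0 q1] hB mu0; rewrite -[leRHS]mul1r -q1 mulr_suml.
apply: (le_trans (ler_norm_sum _ _ _)); apply: ler_sum => x _.
rewrite normrM (ger0_norm (q0 x)) ler_wpM2l // mulrC.
have -> : \sum_y Ppow P s x y * phi y = \sum_y (Ppow P s x y - mu y) * phi y.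
  by under [RHS]eq_bigr do rewrite mulrBl; rewrite sumrB mu0 subr0.
apply: (le_trans (ler_norm_sum _ _ _)).
have B0 : 0 <= B by exact: le_trans (hB x).
apply: (@le_trans _ _ (l1dist s x * B)).
  by rewrite mulr_suml; apply: ler_sum => y _; rewrite normrM ler_wpM2l.
by rewrite ler_wpM2r ?l1dist_le_rho.
Qed.

End Mixing.

(** * Expectations over finite paths of the chain *)

Section PathExpectation.
Variables (R : realType) (Om : finType) (P : Om -> Om -> R).
Hypothesis P_stoch : stochastic P.
Implicit Types (q : Om -> R) (s : seq Om) (phi psi : seq Om -> R).

(* [q] is the law of the next sample of the chain. *)
Fixpoint pathw q s : R := if s is x :: s' then q x * pathw (P x) s' else 1.

(** The last state of [s] selects a row of [P]; an empty [s] leaves [q]. *)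
Definition next_law q s : Om -> R := foldl (fun _ => P) q s.

Definition Epath q n phi : R := \sum_(s : n.-tuple Om) pathw q s * phi s.

Lemma pathw_cat q s s' : pathw q (s ++ s') = pathw q s * pathw (next_law q s) s'.
Proof.
by elim: s q => [|x s IH] q /=; rewrite ?mul1r // IH mulrA.
Qed.

Lemma pathw_ge0 q s : (forall x, 0 <= q x) -> 0 <= pathw q s.
Proof.
elim: s q => [|x s IH] q q0 //=.
by rewrite mulr_ge0 // IH // => y; exact: P_stoch.1.
Qed.

Lemma next_law_prob q s : prob_distr q -> prob_distr (next_law q s).
Proof.
elim: s q => [|x s IH] q hq //=; apply: IH; split; first exact: P_stoch.1.
exact: P_stoch.2.
Qed.

Lemma prob_P x : prob_distr (P x).
Proof. by split; [exact: P_stoch.1|exact: P_stoch.2]. Qed.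

Lemma Epath0 q phi : Epath q 0 phi = phi [::].
Proof.
rewrite /Epath (bigD1 [tuple]) //= mul1r big1 ?addr0 // => s /eqP[].
exact: tuple0.
Qed.

Lemma EpathS q n phi :
  Epath q n.+1 phi = \sum_x q x * Epath (P x) n (fun s => phi (x :: s)).
Proof.
rewrite /Epath; under [RHS]eq_bigr do rewrite mulr_sumr.
rewrite [RHS]pair_big /= (reindex (fun p : Om * n.-tuple Om => cons_tuple p.1 p.2)) /=.
  by apply: eq_bigr => -[x s] _ /=; rewrite mulrA.
exists (fun t : n.+1.-tuple Om => (thead t, behead_tuple t)) => [[x s] _|t _].
  by rewrite theadE; congr pair; apply: val_inj.
by rewrite [RHS](tuple_eta t); apply: val_inj.
Qed.

Lemma EpathD q n phi psi :
  Epath q n (fun s => phi s + psi s) = Epath q n phi + Epath q n psi.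
Proof. by rewrite -big_split; apply: eq_bigr => s _; rewrite mulrDr. Qed.

Lemma EpathZ q n c phi : Epath q n (fun s => c * phi s) = c * Epath q n phi.
Proof. by rewrite mulr_sumr; apply: eq_bigr => s _; rewrite mulrCA. Qed.

Lemma eq_Epath q n phi psi :
  (forall s, size s = n -> phi s = psi s) -> Epath q n phi = Epath q n psi.
Proof. by move=> h; apply: eq_bigr => s _; rewrite h ?size_tuple. Qed.

Lemma Epath_le q n phi psi : (forall x, 0 <= q x) ->
  (forall s, size s = n -> phi s <= psi s) -> Epath q n phi <= Epath q n psi.
Proof.
by move=> q0 h; apply: ler_sum => s _; rewrite ler_wpM2l ?pathw_ge0 ?h ?size_tuple.
Qed.

Lemma Epath_cst q n c : prob_distr q -> Epath q n (fun=> c) = c.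
Proof.
elim: n q => [|n IH] q hq; first by rewrite Epath0.
rewrite EpathS (eq_bigr (fun x => q x * c)) => [|x _]; last by rewrite IH //; exact: prob_P.
by rewrite -mulr_suml hq.2 mul1r.
Qed.

Lemma Epath_take q m n phi : prob_distr q ->
  Epath q (m + n) (fun s => phi (take m s)) = Epath q m phi.
Proof.
elim: m q phi => [|m IH] q phi hq.
  by rewrite Epath0 -[RHS](Epath_cst (0 + n) (phi [::]) hq);
    apply: eq_Epath => s _; rewrite take0.
rewrite addSn !EpathS; apply: eq_bigr => x _; congr (_ * _).
by rewrite -IH //; exact: prob_P.
Qed.

Lemma Epath_sum q n (phi : Om -> R) : prob_distr q ->
  Epath q n (fun s => \sum_(x <- s) phi x)
  = \sum_(k < n) \sum_x q x * \sum_y Ppow P k x y * phi y.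
Proof.
elim: n q => [|n IH] q hq; first by rewrite Epath0 big_nil big_ord0.
rewrite EpathS big_ord_recl.
have E x : Epath (P x) n (fun s => \sum_(y <- x :: s) phi y)
    = phi x + \sum_(k < n) \sum_u P x u * \sum_y Ppow P k u y * phi y.
  have hx := prob_P x.
  rewrite -(IH _ hx) -[X in X + _](Epath_cst n (phi x) hx) -EpathD.
  by apply: eq_Epath => s _; rewrite big_cons.
under eq_bigr do rewrite E mulrDr.
rewrite big_split /=; congr (_ + _).
  apply: eq_bigr => x _; rewrite (bigD1 x) //= eqxx mul1r big1 ?addr0 // => y.
  by rewrite eq_sym => /negPf ->; rewrite mul0r.
under eq_bigr do rewrite mulr_sumr.
rewrite exchange_big /=; apply: eq_bigr => k _; apply: eq_bigr => x _; congr (_ * _).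
under eq_bigr do rewrite mulr_sumr.
rewrite exchange_big /=; apply: eq_bigr => y _.
under eq_bigr do rewrite mulrA.
rewrite -mulr_suml; congr (_ * _).
(* The path exposes its first step whereas [Ppow] is built from its last one; splitting at [1 + k]
   reconciles the two. *)
have := Ppow_add P 1 k x y; rewrite add1n /= => ->; apply: eq_bigr => u _; congr (_ * _).
by rewrite (bigD1 x) //= eqxx mul1r big1 ?addr0 // => v; rewrite eq_sym => /negPf ->; rewrite mul0r.
Qed.

Variable mu : Om -> R.
Hypothesis mu_stat : stationary P mu.

Lemma Epath_sum_le q n (phi : Om -> R) B : prob_distr q ->
  (forall x, `|phi x| <= B) -> \sum_x mu x * phi x = 0 ->
  `|Epath q n (fun s => \sum_(x <- s) phi x)| <= B * \sum_(k < n) rho P mu k.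
Proof.
move=> hq hB mu0; rewrite Epath_sum // mulr_sumr.
apply: (le_trans (ler_norm_sum _ _ _)); apply: ler_sum => k _.
exact: Ppow_mean0_le.
Qed.

(** Expand the square at the first sample [x]. Given [x], the rest of the path starts from [P x], so
    the cross term is a mean-zero sum controlled by [Epath_sum_le], and the second moment grows
    linearly in [n] despite the dependence. *)
Lemma Epath_sqr_sum_le q n d (h : Om -> 'rV[R]_d) (B C : R) : prob_distr q ->
  (forall x, dot (h x) (h x) <= B) ->
  (forall v, \sum_x mu x * dot (h x) v = 0) ->
  (forall N, \sum_(k < N) rho P mu k <= C) ->
  Epath q n (fun s => dot (\sum_(x <- s) h x) (\sum_(x <- s) h x))
  <= n%:R * (B + 2 * (B * C)).
Proof.
move=> hq hB mu0 hC; elim: n q hq => [|n IH] q hq.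
  by rewrite Epath0 big_nil dot0l mul0r.
rewrite EpathS -natr1 mulrDl mul1r addrC.
set D := B + 2 * (B * C) in IH *.
apply: (@le_trans _ _ (\sum_x q x * (D + n%:R * D))); last first.
  by rewrite -mulr_suml hq.2 mul1r.
apply: ler_sum => x _; apply: ler_wpM2l; first exact: hq.1.
have hx := prob_P x.
have B0 : 0 <= B by exact: le_trans (dotvv_ge0 _) (hB x).
rewrite (@eq_Epath _ _ _ (fun s => (dot (h x) (h x) +
    2 * (\sum_(y <- s) dot (h y) (h x))) +
    dot (\sum_(y <- s) h y) (\sum_(y <- s) h y))); last first.
  move=> s _; rewrite big_cons !dotDl !dotDr -dot_suml.
  by rewrite (dotC (h x) (\sum_(y <- s) _)); ring.
rewrite EpathD EpathD EpathZ Epath_cst // -!addrA; apply: lerD => //.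
apply: lerD; last exact: IH.
apply: ler_wpM2l => //; apply: le_trans (ler_norm _) _.
apply: le_trans (@Epath_sum_le _ n _ B hx _ (mu0 (h x))) _; last exact: ler_wpM2l.
by move=> y; exact: dot_norm_le.
Qed.

End PathExpectation.

(** * Bias and second moment of the multilevel estimator *)

Section MultilevelEstimator.
Variables (R : realType) (Om : finType) (P : Om -> Om -> R) (mu : Om -> R) (tau : nat).
Hypothesis P_stoch : stochastic P.
Hypothesis mu_stat : stationary P mu.
Hypothesis tau_mix : is_tau_mix P mu tau.
Local Notation tau' := (maxn 1 tau).

Variables (T K : nat) (p : nat -> R).
Hypothesis T_gt0 : (0 < T)%N.
Hypothesis T_lt : (T < 2 ^ K)%N.
Hypothesis p_ge0 : forall j, 0 <= p j.
Hypothesis p_pow : forall j, (0 < j < K)%N -> p j = (2 ^+ j)^-1.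
Hypothesis p_sum1 : \sum_(0 <= j < K.+1) p j = 1.

Variables (d : nat).
Implicit Types (h : Om -> 'rV[R]_d) (q : Om -> R) (s : seq Om).

Definition avg h j s : 'rV[R]_d := (2 ^+ j)^-1 *: \sum_(x <- take (2 ^ j) s) h x.

Definition mlmc h j s : 'rV[R]_d :=
  if (2 ^ j <= T)%N then avg h 0 s + 2 ^+ j *: (avg h j s - avg h j.-1 s)
  else avg h 0 s.

Definition mean h : 'rV[R]_d := \sum_x mu x *: h x.

Lemma avg_take h i j s : (i <= j)%N -> avg h i (take (2 ^ j) s) = avg h i s.
Proof. by move=> ij; rewrite /avg take_takel // leq_exp2l. Qed.

Lemma Epath_pow_take q i j (phi : seq Om -> R) : prob_distr q -> (i <= j)%N ->
  (forall s, phi (take (2 ^ i) s) = phi s) ->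
  Epath P q (2 ^ j) phi = Epath P q (2 ^ i) phi.
Proof.
move=> hq ij h; have ij2 : (2 ^ i <= 2 ^ j)%N by rewrite leq_exp2l.
rewrite -(subnKC ij2) -(Epath_take P_stoch (2 ^ i) (2 ^ j - 2 ^ i) phi hq).
by apply: eq_Epath => s _; rewrite h.
Qed.

Local Notation jmax := (trunc_log 2 T).

Lemma pow_le_T j : (2 ^ j <= T)%N = (j <= jmax)%N.
Proof.
apply/idP/idP => [|jm]; first exact: trunc_log_max.
by apply: (@leq_trans (2 ^ jmax)); rewrite ?leq_exp2l // trunc_logP.
Qed.

Lemma jmax_lt : (jmax < K)%N.
Proof.
by rewrite -(@ltn_exp2l 2) // (leq_ltn_trans _ T_lt) // trunc_logP.
Qed.

(** The weight [p j] is the inverse of the factor [2 ^+ j] on the correction levels. These lie below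
    [K] because [jmax < K], and the mass at [K] is multiplied by 0. *)
Lemma mlmc_sum (a : nat -> R) :
  \sum_(0 <= j < K.+1) p j * (if (0 < j <= jmax)%N then 2 ^+ j * a j else 0)
  = \sum_(1 <= j < jmax.+1) a j.
Proof.
rewrite (@big_cat_nat _ _ _ jmax.+1) //=; last by rewrite ltnW // ltnS jmax_lt.
rewrite [X in _ + X]big_nat_cond [X in _ + X]big1 => [|j]; last first.
  by rewrite andbT => /andP[jj _]; rewrite (leqNgt j) jj andbF mulr0.
rewrite addr0 big_ltn // mulr0 add0r big_nat_cond [RHS]big_nat_cond.
apply: eq_bigr => j; rewrite andbT ltnS => jj; rewrite jj.
have /andP[j0 jm] := jj.
rewrite p_pow ?j0 ?(leq_ltn_trans jm jmax_lt) // mulrA mulVf ?mul1r //.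
Qed.

Variables (h : Om -> 'rV[R]_d) (B : R) (q : Om -> R).
Hypothesis h_le : forall x, dot (h x) (h x) <= B.
Hypothesis q_prob : prob_distr q.
Local Notation m := (mean h).

Lemma dot_mean v : dot m v = \sum_x mu x * dot (h x) v.
Proof. by rewrite dot_suml; apply: eq_bigr => x _; rewrite dotZl. Qed.

(** Averaging [dot (h x) m <= (B + dot m m) / 2] over [mu] bounds [dot m m] by half of itself plus
    [B / 2]. *)
Lemma dot_mean_le : dot m m <= B.
Proof.
have [[mu0 mu1] _] := mu_stat.
suff : dot m m <= 2^-1 * (B + dot m m) by lra.
have -> : 2^-1 * (B + dot m m) = \sum_x mu x * (2^-1 * (B + dot m m)).
  by rewrite -mulr_suml mu1 mul1r.
rewrite {1}dot_mean; apply: ler_sum => x _.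
apply: ler_wpM2l => //; have := dotvv_ge0 (h x - m); have := h_le x.
rewrite dotBl !dotBr (dotC m (h x)); lra.
Qed.

Lemma dot_centered_le x : dot (h x - m) (h x - m) <= 4 * B.
Proof. by have := dotvvB_le (h x) m; have := h_le x; have := dot_mean_le; lra. Qed.

Lemma sum_centered0 v : \sum_x mu x * dot (h x - m) v = 0.
Proof.
under eq_bigr do rewrite dotBl mulrBr.
by rewrite sumrB -mulr_suml mu_stat.1.2 mul1r -dot_mean subrr.
Qed.

Lemma avgB i s : size s = (2 ^ i)%N ->
  avg h i s - m = (2 ^+ i)^-1 *: \sum_(x <- s) (h x - m).
Proof.
move=> hs; rewrite sumrB big_const_seq count_predT hs iter_addr_0 scalerBr.
rewrite /avg take_oversize ?hs // -[m *+ _]scaler_nat scalerA natrX mulVf ?scale1r //.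
Qed.

Lemma pow2_gt0 i : 0 < 2 ^+ i :> R. Proof. exact: exprn_gt0. Qed.

Lemma sqr_bound_ge0 : 0 <= B. Proof. exact: le_trans (dotvv_ge0 _) dot_mean_le. Qed.

(** Only the component along [m] is measured: [m] will be the gradient of [F] at the iterate, and
    [dot m m - dot g m] is the error of testing the estimate [g] against it. *)
Definition bias i : R := Epath P q (2 ^ i) (fun s => dot (m - avg h i s) m).

Lemma bias_le i : bias i <= (2 ^+ i)^-1 * (4 * B * \sum_(k < 2 ^ i) rho P mu k).
Proof.
rewrite /bias (@eq_Epath _ _ _ _ _ _
  (fun s => (2 ^+ i)^-1 * \sum_(x <- s) - dot (h x - m) m)); last first.
  move=> s hs; rewrite -[m - _]opprB dotNl avgB // dotZl dot_suml.
  by rewrite sumrN mulrN.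
rewrite EpathZ; apply: ler_wpM2l; first by rewrite invr_ge0 ltW ?pow2_gt0.
apply: le_trans (ler_norm _) _; apply: Epath_sum_le => // [x|].
  rewrite normrN; apply: dot_norm_le; first exact: dot_centered_le.
  by have := dot_mean_le; have := sqr_bound_ge0; lra.
by under eq_bigr do rewrite mulrN; rewrite sumrN sum_centered0 oppr0.
Qed.

Lemma avg_sqr_le i :
  Epath P q (2 ^ i) (fun s => dot (avg h i s - m) (avg h i s - m))
  <= 36 * B * tau'%:R * (2 ^+ i)^-1.
Proof.
rewrite (@eq_Epath _ _ _ _ _ _ (fun s => ((2 ^+ i)^-1 * (2 ^+ i)^-1) *
  dot (\sum_(x <- s) (h x - m)) (\sum_(x <- s) (h x - m)))); last first.
  by move=> s hs; rewrite avgB // dotZl dotZr mulrA.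
rewrite EpathZ.
have := Epath_sqr_sum_le P_stoch (2 ^ i) q_prob dot_centered_le
  sum_centered0 (fun N => sum_rho_tau P_stoch mu_stat N tau_mix).
set E := Epath _ _ _ _ => hE.
have t1 : 1 <= tau'%:R :> R by rewrite ler1n leq_maxl.
(* A centered sample contributes [4 B] and its cross terms [2 * 4 B * 4 tau']; since [1 <= tau'],
   the total is at most [36 B tau']. *)
have : 4 * B + 2 * (4 * B * (4 * tau'%:R)) <= 36 * B * tau'%:R.
  have := ler_wpM2l sqr_bound_ge0 t1; lra.
move=> hB; have p0 := pow2_gt0 i.
rewrite -[leLHS]mulrA [leRHS]mulrC ler_wpM2l ?invr_ge0 ?(ltW p0) //.
rewrite ler_pdivrMl // mulrC; apply: le_trans hE _; rewrite natrX mulrC.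
by rewrite ler_wpM2l // ltW.
Qed.

(** Each [avg h i] reads only the first [2 ^ i] samples, so its expectation over the longer block is
    that of level [i] alone. *)
Lemma Epath_mlmc_bias j :
  Epath P q (2 ^ j) (fun s => dot (m - mlmc h j s) m) =
  bias 0 + (if (0 < j <= jmax)%N then 2 ^+ j * (bias j - bias j.-1) else 0).
Proof.
have takeE i : (i <= j)%N ->
    Epath P q (2 ^ j) (fun s => dot (m - avg h i s) m) = bias i.
  by move=> ij; apply: Epath_pow_take => // s; rewrite avg_take.
rewrite -(takeE 0) // /mlmc pow_le_T.
have [jm|jm] := leqP j jmax; rewrite ?andbT ?andbF ?addr0 //.
case: (posnP j) => [->|j0]; first by rewrite addr0;
  apply: eq_Epath => s _; rewrite subrr scaler0 addr0.
rewrite -(takeE j) // -(takeE j.-1) ?leq_pred //.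
rewrite -[X in _ = _ + _ * (_ + X)]mulN1r -EpathZ -EpathD -EpathZ -EpathD.
by apply: eq_Epath => s _; rewrite !dotBl dotDl dotZl !dotBl; ring.
Qed.

(** Once the weights cancel, the differences [bias j - bias j.-1] telescope and only [bias jmax],
    that of the longest average, is left. *)
Lemma mlmc_bias_le :
  \sum_(0 <= j < K.+1) p j * Epath P q (2 ^ j) (fun s => dot (m - mlmc h j s) m)
  <= (2 ^+ jmax)^-1 * (4 * B * \sum_(k < 2 ^ jmax) rho P mu k).
Proof.
under eq_bigr do rewrite Epath_mlmc_bias mulrDr.
rewrite big_split /= -mulr_suml p_sum1 mul1r mlmc_sum big_add1 /= telescope_sumr //.
by rewrite addrC subrK bias_le.
Qed.

Lemma dot_avg0_le s : dot (avg h 0 s) (avg h 0 s) <= B.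
Proof.
rewrite /avg expr0 invr1 scale1r expn0.
case: s => [|x s]; first by rewrite big_nil dot0l sqr_bound_ge0.
by rewrite /= take0 big_seq1.
Qed.

(** Both averages in the correction are compared with [m]. Their second moments are at most
    [36 B tau' / 2^j] and twice that, so the factor [4 * 2^j * 2^j] leaves [4 * 36 * 3 = 432] times
    [B tau' 2^j]. *)
Lemma Epath_mlmc_sqr_le j :
  Epath P q (2 ^ j) (fun s => dot (mlmc h j s) (mlmc h j s)) <=
  2 * B + (if (0 < j <= jmax)%N then 2 ^+ j * (432 * B * tau'%:R) else 0).
Proof.
have B0 := sqr_bound_ge0; have q0 := q_prob.1.
rewrite /mlmc pow_le_T.
have hc : Epath P q (2 ^ j) (fun s => dot (avg h 0 s) (avg h 0 s)) <= 2 * B.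
  rewrite -[leRHS](Epath_cst P_stoch (2 ^ j) (2 * B) q_prob).
  by apply: Epath_le => // s _; have := dot_avg0_le s; lra.
have [jm|jm] := leqP j jmax; rewrite ?andbT ?andbF ?addr0 //.
case: (posnP j) => [->|j0].
  rewrite addr0 -[leRHS](Epath_cst P_stoch (2 ^ 0) (2 * B) q_prob).
  apply: Epath_le => // s _; rewrite subrr scaler0 addr0.
  by have := dot_avg0_le s; lra.
pose Q i s := dot (avg h i s - m) (avg h i s - m).
apply: (@le_trans _ _ (Epath P q (2 ^ j) (fun s => 2 * B +
    (4 * (2 ^+ j * 2 ^+ j)) * (Q j s + Q j.-1 s)))).
  apply: Epath_le => // s _; apply: le_trans (dotvvD_le _ _) _.
  apply: lerD; first by have := dot_avg0_le s; lra.
  rewrite dotZl dotZr; set a := 2 ^+ j.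
  have a0 : 0 <= a by rewrite ltW ?pow2_gt0.
  have -> : avg h j s - avg h j.-1 s = (avg h j s - m) - (avg h j.-1 s - m).
    by rewrite opprB addrA subrK.
  have := dotvvB_le (avg h j s - m) (avg h j.-1 s - m); rewrite -/(Q j s) -/(Q j.-1 s).
  move=> /(ler_wpM2l (mulr_ge0 a0 a0)); lra.
rewrite EpathD Epath_cst // EpathZ EpathD lerD2l.
rewrite [X in _ + X](@Epath_pow_take q j.-1 j) ?leq_pred //; last first.
  by move=> s; rewrite /Q avg_take.
have h1 := avg_sqr_le j; have h2 := avg_sqr_le j.-1.
have E2 : (2 ^+ j.-1)^-1 = 2 * (2 ^+ j)^-1 :> R.
  by rewrite -{2}(prednK j0) exprS invfM mulrA mulfV ?mul1r.
rewrite E2 in h2; rewrite -/(Q j) in h1; rewrite -/(Q j.-1) in h2.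
have p0 := pow2_gt0 j; set a := 2 ^+ j in p0 h1 h2 *.
have a2 : 0 <= 4 * (a * a) by rewrite !mulr_ge0 // ltW.
have := ler_wpM2l a2 (lerD h1 h2); move/le_trans; apply.
rewrite le_eqVlt; apply/orP; left; apply/eqP; field.
by rewrite gt_eqF.
Qed.

(** The weights cancel the remaining [2 ^+ j], so each of the [jmax] levels contributes the same
    amount; this is the source of the logarithm. *)
Lemma mlmc_sqr_le :
  \sum_(0 <= j < K.+1) p j * Epath P q (2 ^ j) (fun s => dot (mlmc h j s) (mlmc h j s))
  <= 432 * B * tau'%:R * (1 + jmax%:R).
Proof.
apply: (@le_trans _ _ (\sum_(0 <= j < K.+1) p j * (2 * B +
    (if (0 < j <= jmax)%N then 2 ^+ j * (432 * B * tau'%:R) else 0)))).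
  by apply: ler_sum => j _; rewrite ler_wpM2l // Epath_mlmc_sqr_le.
under eq_bigr do rewrite mulrDr.
rewrite big_split /= -mulr_suml p_sum1 mul1r mlmc_sum.
rewrite sumr_const_nat subn1 /= -mulr_natr.
have t1 : 1 <= tau'%:R :> R by rewrite ler1n leq_maxl.
have := ler_wpM2l sqr_bound_ge0 t1; have := sqr_bound_ge0; lra.
Qed.

End MultilevelEstimator.

(** * Gradients, derivatives along lines and the descent inequality *)

Section Gradient.
Variables (R : realType) (d : nat).
Implicit Types (F : 'rV[R]_d -> R) (v w : 'rV[R]_d).

Lemma derive_grad F w v : differentiable F w -> 'D_v F w = dot (grad F w) v.
Proof.
move=> dF; rewrite deriveE // {1}(row_sum_delta v) linear_sum.
by apply: eq_bigr => i _; rewrite linearZ mxE deriveE // mulrC.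
Qed.

Lemma grad_weighted_sum (I : finType) (c : I -> R) (f : I -> 'rV[R]_d -> R) w :
  (forall x, differentiable (f x) w) ->
  grad (fun w => \sum_x c x * f x w) w = \sum_x c x *: grad (f x) w.
Proof.
move=> df; apply/rowP => i; rewrite summxE mxE.
have H (r : seq I) v : is_derive w v (fun w => \sum_(x <- r) c x * f x w)
    (\sum_(x <- r) c x * 'D_v (f x) w).
  elim: r => [|x r IH].
    rewrite big_nil; have -> : (fun w => \sum_(x <- [::]) c x * f x w) = cst 0.
      by apply/funext => u; rewrite big_nil.
    exact: is_derive_cst.
  rewrite big_cons; have -> : (fun w => \sum_(x <- x :: r) c x * f x w)
      = (c x \*: f x) + (fun w => \sum_(x <- r) c x * f x w).
    by apply/funext => u; rewrite big_cons.
  apply: is_deriveD; apply: is_deriveZ; apply: derivableP.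
  exact: diff_derivable.
rewrite (@derive_val _ _ _ _ _ _ _ (H (index_enum I) _)).
by apply: eq_bigr => x _; rewrite !mxE.
Qed.

Lemma is_derive_line F w v (t : R) : differentiable F (w + t *: v) ->
  is_derive t 1 (fun s : R => F (w + s *: v)) (dot (grad F (w + t *: v)) v).
Proof.
move=> dF; have E : (fun s : R => s^-1 *:
      (((fun s : R => F (w + s *: v)) \o shift t) (s *: 1) - F (w + t *: v)))
    = (fun s : R => s^-1 *: ((F \o shift (w + t *: v)) (s *: v) - F (w + t *: v))).
  apply/funext => s /=; congr (_ *: (F _ - _)).
  by rewrite [s *: 1]mulr1 scalerDl addrCA.
split.
  by rewrite /derivable E; exact: diff_derivable.
by rewrite -derive_grad // /derive E.
Qed.

Lemma smooth_descent F (L : R) : 0 <= L -> (forall w, differentiable F w) ->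
  (forall u v, enorm (grad F u - grad F v) <= L * enorm (u - v)) ->
  forall w v, F (w + v) <= F w + dot (grad F w) v + L / 2 * dot v v.
Proof.
move=> L0 dF lip w v.
pose a := dot (grad F w) v; pose b := L / 2 * dot v v.
(* The slope [2 b c = L c dot v v] of the quadratic term offsets the Lipschitz bound on the change
   of gradient, so the mean value theorem gives [phi 1 <= phi 0]. *)
pose phi (t : R) := F (w + t *: v) - t * a - b * t ^+ 2.
pose dphi (t : R) := dot (grad F (w + t *: v)) v - a - b * (2 * t).
have Dphi (t : R) : is_derive t 1 phi (dphi t).
  have h1 := is_derive_line (dF (w + t *: v)).
  have h2 : is_derive t 1 (fun t : R => t * a) a.
    have -> : (fun t : R => t * a) = (a \*: id) by apply/funext => s; rewrite mulrC.
    by apply: is_derive_eq; rewrite [a *: 1]mulr1.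
  have h3 : is_derive t 1 (fun t : R => b * t ^+ 2) (b * (2 * t)).
    have -> : (fun t : R => b * t ^+ 2) = (b \*: (id ^+ 2)) by apply/funext.
    apply: is_derive_eq.
    rewrite /GRing.scale /=; ring.
  by have := is_deriveB (is_deriveB h1 h2) h3.
have [c] := @MVT _ phi dphi 0 1 ltr01 (fun t _ => Dphi t)
  (derivable_within_continuous (fun t _ => @ex_derive _ _ _ _ _ _ _ (Dphi t))).
rewrite in_itv /= => /andP[c0 c1].
rewrite /phi /dphi scale1r scale0r addr0 !mul1r mul0r expr1n expr0n /=.
rewrite !mulr1 mulr0 !subr0 mulr1 => E.
have : dot (grad F (w + c *: v) - grad F w) v <= L * c * dot v v.
  apply: le_trans (dot_le _ _) _.
  apply: (@le_trans _ _ (L * enorm (c *: v) * enorm v)).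
    by rewrite ler_wpM2r ?enorm_ge0 // (le_trans (lip _ _)) // addrC addKr.
  by rewrite enormZ gtr0_norm // -enorm_sqr expr2 !mulrA.
rewrite dotBl -/a => h.
have : F (w + v) - a - b - F w <= 0 by rewrite E /b; lra.
rewrite -/b; lra.
Qed.

End Gradient.

(** * Expectations over sequences of levels and blocks *)

Section TrajectoryExpectation.
Variables (R : realType) (Om : finType) (P : Om -> Om -> R).
Hypothesis P_stoch : stochastic P.
Variables (K : nat) (p : nat -> R).
Hypothesis p_ge0 : forall j, 0 <= p j.
Hypothesis p_sum1 : \sum_(0 <= j < K.+1) p j = 1.

(* A trajectory is the list of the levels [J_t] together with the blocks of samples. *)
Local Notation traj := (seq (nat * seq Om)).
Implicit Types (q : Om -> R) (Phi Psi : traj -> R).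

Fixpoint Etraj q n Phi : R :=
  if n is n'.+1 then \sum_(0 <= j < K.+1) p j *
    Epath P q (2 ^ j) (fun s => Etraj (next_law P q s) n' (fun tr => Phi ((j, s) :: tr)))
  else Phi [::].

Lemma Etraj_cst q n c : prob_distr q -> Etraj q n (fun=> c) = c.
Proof.
elim: n q => [//|n IH] q hq /=.
rewrite (eq_bigr (fun j => p j * c)) => [|j _]; first by rewrite -mulr_suml p_sum1 mul1r.
congr (_ * _); rewrite -[RHS](Epath_cst P_stoch (2 ^ j) c hq).
by apply: eq_Epath => s _; apply: IH; exact: next_law_prob.
Qed.

Lemma EtrajD q n Phi Psi :
  Etraj q n (fun tr => Phi tr + Psi tr) = Etraj q n Phi + Etraj q n Psi.
Proof.
elim: n q Phi Psi => [//|n IH] q Phi Psi /=.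
rewrite -big_split; apply: eq_bigr => j _ /=; rewrite -mulrDr -EpathD; congr (_ * _).
by apply: eq_Epath => s _; rewrite IH.
Qed.

Lemma EtrajZ q n c Phi : Etraj q n (fun tr => c * Phi tr) = c * Etraj q n Phi.
Proof.
elim: n q Phi => [//|n IH] q Phi /=.
rewrite mulr_sumr; apply: eq_bigr => j _ /=; rewrite [RHS]mulrCA -[X in _ = _ * X]EpathZ; congr (_ * _).
by apply: eq_Epath => s _; rewrite IH.
Qed.

Lemma Etraj_le q n Phi Psi : prob_distr q -> (forall tr, Phi tr <= Psi tr) ->
  Etraj q n Phi <= Etraj q n Psi.
Proof.
elim: n q Phi Psi => [|n IH] q Phi Psi hq h /=; first exact: h.
apply: ler_sum => j _; apply: ler_wpM2l => //.
apply: Epath_le => // [|s _]; first exact: hq.1.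
by apply: IH => //; exact: next_law_prob.
Qed.

(** Nonnegativity of the variance; it is the form of Jensen's inequality used for [E sqrt a_T]. *)
Lemma Etraj_sqr q n Phi : prob_distr q ->
  Etraj q n Phi ^+ 2 <= Etraj q n (fun tr => Phi tr ^+ 2).
Proof.
move=> hq; set m := Etraj q n Phi.
have : 0 <= Etraj q n (fun tr => Phi tr ^+ 2 + (- (2 * m) * Phi tr + m ^+ 2)).
  rewrite -[leLHS](Etraj_cst n 0 hq); apply: Etraj_le => // tr.
  have := sqr_ge0 (Phi tr - m); nra.
rewrite !EtrajD EtrajZ Etraj_cst // -/m; nra.
Qed.

Variables (S : Type) (step : S -> nat * seq Om -> S).

(** An additive functional of the run: [c] is charged at the state that precedes the block. *)
Fixpoint trajsum (c : S -> nat * seq Om -> R) (st : S) (tr : traj) : R :=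
  if tr is b :: tr' then c st b + trajsum c (step st b) tr' else 0.

(** Conditioning on the past: [V] bounds the expected cost of one block from every state and every
    law of the next sample, so dependence between blocks is harmless. *)
Lemma Etraj_trajsum_le (c : S -> nat * seq Om -> R) V :
  (forall st q, prob_distr q ->
    \sum_(0 <= j < K.+1) p j * Epath P q (2 ^ j) (fun s => c st (j, s)) <= V) ->
  forall n st q, prob_distr q -> Etraj q n (trajsum c st) <= n%:R * V.
Proof.
move=> hc; elim=> [|n IH] st q hq /=; first by rewrite mul0r.
rewrite -natr1 mulrDl mul1r addrC.
apply: (@le_trans _ _ (\sum_(0 <= j < K.+1) (p j * Epath P q (2 ^ j) (fun s => c st (j, s))
    + p j * (n%:R * V)))); last first.
  by rewrite big_split /= -mulr_suml p_sum1 mul1r lerD2r hc.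
apply: ler_sum => j _; rewrite -mulrDr ler_wpM2l //.
rewrite -[X in _ + X](Epath_cst P_stoch (2 ^ j) _ hq) -EpathD.
apply: Epath_le => // [|s _]; first exact: hq.1.
have hs := next_law_prob P_stoch s hq.
by rewrite EtrajD Etraj_cst // lerD2l IH.
Qed.

Lemma trajsumB (c c' : S -> nat * seq Om -> R) st tr :
  trajsum (fun st b => c st b - c' st b) st tr = trajsum c st tr - trajsum c' st tr.
Proof. by elim: tr st => [|b tr IH] st /=; rewrite ?subr0 // IH; ring. Qed.

Lemma trajsum_ge0 (c : S -> nat * seq Om -> R) st tr :
  (forall st b, 0 <= c st b) -> 0 <= trajsum c st tr.
Proof. by move=> c0; elim: tr st => [|b tr IH] st //=; rewrite addr_ge0. Qed.

Lemma trajsum_rcons c st tr b :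
  trajsum c st (rcons tr b) = trajsum c st tr + c (foldl step st tr) b.
Proof.
by elim: tr st => [|b' tr IH] st /=; rewrite ?addr0 ?add0r // IH addrA.
Qed.

End TrajectoryExpectation.

(** * Pathwise analysis of the adaptive step size *)

Section AdaptiveDescent.
Variables (R : realType) (Om : finType) (d T : nat) (h : Om -> 'rV[R]_d -> 'rV[R]_d).
Implicit Types (st : 'rV[R]_d * R) (b : nat * seq Om).

Definition est st b := mlmc T (h^~ st.1) b.1 b.2.

(** The state is the pair of [w_t] and [a_(t-1)]; the step size uses the sum updated by the present
    estimate. *)
Definition mag_step st b :=
  (st.1 - (1 / Num.sqrt (st.2 + enorm (est st b) ^+ 2)) *: est st b,
   st.2 + enorm (est st b) ^+ 2).

Variables (F : 'rV[R]_d -> R) (M L : R).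
Hypothesis L_ge0 : 0 <= L.
Hypothesis F_diff : forall w, differentiable F w.
Hypothesis F_smooth : forall u v, enorm (grad F u - grad F v) <= L * enorm (u - v).
Hypothesis F_le : forall w, `|F w| <= M.

(** This is the descent inequality times [s' = sqrt a_t]. The squared norm of the estimate is
    [s'^2 - s^2], so the quadratic term is [L / 2 * (s'^2 - s^2) / s'], at most [L (s' - s)] because
    [s <= s']. *)
Lemma mag_step_le st b : 0 <= st.2 ->
  dot (est st b) (grad F st.1) <=
  Num.sqrt (mag_step st b).2 * (F st.1 - F (mag_step st b).1)
  + L * (Num.sqrt (mag_step st b).2 - Num.sqrt st.2).
Proof.
case: st => w a a0; rewrite /mag_step; set g := est _ _ => /=.
rewrite enorm_sqr; set a' := a + dot g g.
have g0 := dotvv_ge0 g.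
have a'0 : 0 <= a' by rewrite addr_ge0.
(* If [a'] vanishes then so do [g] and [a], and both sides are zero whatever the value of the step
   size [1 / 0]. *)
have [z|z] := eqVneq a' 0.
  have gz : dot g g = 0 by move: z g0 a0; rewrite /= /a'; lra.
  have az : a = 0 by move: z; rewrite /a' gz addr0.
  by rewrite z az (dotvv_eq0 gz) dot0l sqrtr0 subrr mul0r mulr0 addr0.
have s'0 : 0 < Num.sqrt a' by rewrite sqrtr_gt0 lt_def z.
have E := sqr_sqrtr a'0; have E0 := sqr_sqrtr a0; have s0 := sqrtr_ge0 a.
have := smooth_descent L_ge0 F_diff F_smooth w (- ((1 / Num.sqrt a') *: g)).
set w' := w - _; set s' := Num.sqrt a' in s'0 E *; set s := Num.sqrt a in E0 s0 *.
rewrite -scaleNr dotZl dotZr dotZr (dotC (grad F w)); set D := dot g (grad F w).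
have Eg : dot g g = s' ^+ 2 - s ^+ 2 by rewrite E E0 /a' /=; ring.
rewrite Eg.
move=> /(ler_wpM2l (ltW s'0)).
have -> : s' * (F w + - (1 / s') * D + L / 2 * (- (1 / s') * (- (1 / s') * (s' ^+ 2 - s ^+ 2))))
  = s' * F w - D + L / 2 * ((s' ^+ 2 - s ^+ 2) / s').
  by field; rewrite gt_eqF.
have ss : s <= s' by rewrite /s /s' ler_sqrt // /a' lerDl.
have : (s' ^+ 2 - s ^+ 2) / s' <= 2 * (s' - s).
  rewrite ler_pdivrMr //; nra.
move=> /(ler_wpM2l L_ge0); lra.
Qed.

Local Notation sqn := (trajsum mag_step (fun st b => dot (est st b) (est st b))).
Local Notation corr := (trajsum mag_step (fun st b => dot (est st b) (grad F st.1))).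

(* Summation by parts of [sqrt a_t (F w_t - F w_(t+1))]. *)
Lemma corr_le tr st : 0 <= st.2 ->
  corr st tr <= Num.sqrt st.2 * F st.1
    + (2 * M + L) * Num.sqrt (st.2 + sqn st tr) - (M + L) * Num.sqrt st.2.
Proof.
elim: tr st => [|b tr IH] st a0 /=.
  rewrite addr0; have := F_le st.1; rewrite ler_norml => /andP[Fw _].
  have := ler_wpM2l (sqrtr_ge0 st.2) Fw; lra.
have E : (mag_step st b).2 = st.2 + dot (est st b) (est st b) by rewrite /= enorm_sqr.
have a'0 : 0 <= (mag_step st b).2 by rewrite E addr_ge0 ?dotvv_ge0.
have := IH _ a'0; have := mag_step_le b a0.
rewrite addrA -E.
have : Num.sqrt st.2 <= Num.sqrt (mag_step st b).2.
  by rewrite ler_sqrt // E lerDl dotvv_ge0.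
set s := Num.sqrt st.2; set s' := Num.sqrt (mag_step st b).2.
move=> ss h1 h2; apply: (le_trans (lerD h1 h2)).
have := F_le st.1; rewrite ler_norml => /andP[_ Fw].
have : 0 <= s' - s by lra.
move=> /ler_wpM2l /(_ _ _ Fw); lra.
Qed.

Lemma corr0_le tr w :
  corr (w, 0) tr <= (2 * M + L) * Num.sqrt (sqn (w, 0) tr).
Proof. by have := corr_le tr (lexx (w, 0 : R).2); rewrite /= sqrtr0 add0r; lra. Qed.

End AdaptiveDescent.

(** * Truncated geometric law of the levels *)

Section TruncatedGeometric.
Variable R : realType.

(* The law of [min J K] for [J] geometric. *)
Definition tgeom (K j : nat) : R :=
  if j == 0%N then 0 else if (j < K)%N then (2 ^+ j)^-1 else (2 ^+ K.-1)^-1.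

Lemma tgeom_ge0 K j : 0 <= tgeom K j.
Proof. by rewrite /tgeom; do 2 case: ifP => // _; rewrite invr_ge0 exprn_ge0. Qed.

Lemma tgeom_pow K j : (0 < j < K)%N -> tgeom K j = (2 ^+ j)^-1.
Proof. by rewrite /tgeom => /andP[]; case: j => // j _ ->. Qed.

(** The two weights agree below [K]; at [K] the truncated law carries the whole tail. *)
Lemma geom_weight_le K j : (j < K.+1)%N -> geom_weight R j <= tgeom K j.
Proof.
rewrite /geom_weight /tgeom ltnS leq_eqVlt => /orP[/eqP ->|jK]; last first.
  by rewrite lt0n jK; case: eqP.
rewrite ltnn lt0n; case: eqP => //= _.
by rewrite lef_pV2 ?posrE ?exprn_gt0 // ler_eXn2l ?ltr1n // leq_pred.
Qed.

Lemma tgeom_sum1 K : (0 < K)%N -> \sum_(0 <= j < K.+1) tgeom K j = 1.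
Proof.
case: K => // K _; rewrite big_nat_recr //= {2}/tgeom ltnn /=.
suff -> : \sum_(0 <= j < K.+1) tgeom K.+1 j = 1 - (2 ^+ K)^-1 by rewrite subrK.
rewrite (eq_big_nat _ _ (F2 := fun j => if j == 0%N then 0 else (2 ^+ j)^-1)); last first.
  by move=> j /andP[_ jK]; rewrite /tgeom jK.
elim: K => [|K IH]; first by rewrite big_nat1 expr0 invr1 subrr.
rewrite big_nat_recr //= IH exprS invfM; lra.
Qed.

End TruncatedGeometric.

(** * The bound for levels truncated at the cutoff *)

Section FiniteBound.
Variables (R : realType) (Om : finType) (P : Om -> Om -> R) (nu mu : Om -> R) (tau : nat).
Hypothesis P_stoch : stochastic P.
Hypothesis nu_prob : prob_distr nu.
Hypothesis mu_stat : stationary P mu.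
Hypothesis tau_mix : is_tau_mix P mu tau.
Local Notation tau' := (maxn 1 tau).

Variables (d : nat) (f : Om -> 'rV[R]_d -> R) (L M G : R).
Hypothesis f_diff : forall x, forall w : 'rV[R]_d, differentiable (f x) w.
Local Notation F := (fun w : 'rV[R]_d => \sum_x mu x * f x w).
Hypothesis F_diff : forall w, differentiable F w.
Hypothesis L_ge0 : 0 <= L.
Hypothesis F_smooth : forall u v, enorm (grad F u - grad F v) <= L * enorm (u - v).
Hypothesis F_le : forall w, `|F w| <= M.
Hypothesis grad_le : forall x w, enorm (grad (f x) w) <= G.
Local Notation gradf := (fun x w => grad (f x) w).

Variables (T K : nat).
Hypothesis T_gt0 : (0 < T)%N.
Hypothesis T_lt : (T < 2 ^ K)%N.
Local Notation jmax := (trunc_log 2 T).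

Lemma cutoff_gt0 : (0 < K)%N.
Proof. by case: K T_lt => //; rewrite expn0 ltnS leqNgt T_gt0. Qed.

Lemma mean_grad w : mean mu (gradf^~ w) = grad F w.
Proof. by rewrite grad_weighted_sum. Qed.

Lemma dot_grad_le x w : dot (grad (f x) w) (grad (f x) w) <= G ^+ 2.
Proof. exact: dotvv_le. Qed.

Lemma dot_gradF_le w : dot (grad F w) (grad F w) <= G ^+ 2.
Proof. by rewrite -mean_grad; apply: (dot_mean_le mu_stat) => x; exact: dot_grad_le. Qed.

Definition sqgrad (st : 'rV[R]_d * R) (b : nat * seq Om) : R :=
  dot (grad F st.1) (grad F st.1).

(** The squared gradient is its product with the estimate plus an error: [corr0_le] bounds the
    products on each path, and the conditional bias bounds the expected error. *)
Lemma Etraj_sqgrad_le (w1 : 'rV[R]_d) :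
  Etraj P K (tgeom R K) nu T (trajsum (mag_step T gradf) sqgrad (w1, 0)) <=
  (2 * M + L) * Num.sqrt (T%:R * (432 * G ^+ 2 * tau'%:R * (1 + jmax%:R)))
  + T%:R * ((2 ^+ jmax)^-1 * (4 * G ^+ 2 * \sum_(k < 2 ^ jmax) rho P mu k)).
Proof.
have p0 := @tgeom_ge0 R K; have p1 := tgeom_sum1 R cutoff_gt0.
pose g := est T gradf.
pose corr := trajsum (mag_step T gradf) (fun st b => dot (g st b) (grad F st.1)) (w1, 0 : R).
pose sqn := trajsum (mag_step T gradf) (fun st b => dot (g st b) (g st b)) (w1, 0 : R).
pose err := trajsum (mag_step T gradf)
  (fun st b => sqgrad st b - dot (g st b) (grad F st.1)) (w1, 0 : R).
have M0 : 0 <= M by exact: le_trans (normr_ge0 _) (F_le 0).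
have sqn0 tr : 0 <= sqn tr by apply: trajsum_ge0 => *; exact: dotvv_ge0.
have hsqn : Etraj P K (tgeom R K) nu T sqn <= T%:R * (432 * G ^+ 2 * tau'%:R * (1 + jmax%:R)).
  apply: Etraj_trajsum_le => // st q hq.
  apply: (mlmc_sqr_le P_stoch mu_stat tau_mix T_gt0 T_lt p0 (@tgeom_pow R K) p1 _ hq).
  by move=> x; exact: dot_grad_le.
have herr : Etraj P K (tgeom R K) nu T err
    <= T%:R * ((2 ^+ jmax)^-1 * (4 * G ^+ 2 * \sum_(k < 2 ^ jmax) rho P mu k)).
  apply: Etraj_trajsum_le => // st q hq.
  rewrite (eq_bigr (fun j => tgeom R K j * Epath P q (2 ^ j) (fun s =>
     dot (mean mu (gradf^~ st.1) - mlmc T (gradf^~ st.1) j s) (mean mu (gradf^~ st.1)))));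
     last first.
    move=> j _; congr (_ * _); apply: eq_Epath => s _.
    by rewrite mean_grad dotBl.
  apply: (mlmc_bias_le P_stoch mu_stat T_gt0 T_lt (@tgeom_pow R K) p1 _ hq).
  by move=> x; exact: dot_grad_le.
apply: (@le_trans _ _ (Etraj P K (tgeom R K) nu T
    (fun tr => (2 * M + L) * Num.sqrt (sqn tr) + err tr))).
  apply: Etraj_le => // tr; rewrite /err trajsumB.
  have := corr0_le T gradf L_ge0 F_diff F_smooth F_le tr w1.
  by rewrite -/g -/sqn; lra.
have ML0 : 0 <= 2 * M + L by rewrite addr_ge0 ?mulr_ge0.
rewrite EtrajD EtrajZ.
apply: lerD => //.
apply: ler_wpM2l => //.
set E := Etraj _ _ _ _ _ _.
apply: le_trans (ler_norm _) _; rewrite -sqrtr_sqr ler_wsqrtr //.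
apply: le_trans (Etraj_sqr P_stoch p0 p1 _ _ nu_prob) _.
apply: le_trans hsqn; apply: Etraj_le => // tr.
by rewrite sqr_sqrtr.
Qed.

(** From [1 - 1/2 <= exp (- 1/2)] follows [exp (1/2) <= 2]. *)
Lemma half_le_ln2 : 2^-1 <= ln (2 : R).
Proof.
rewrite -[leLHS]expRK ler_ln ?posrE ?expR_gt0 //.
have := expR_ge1Dx (- (2^-1 : R)); rewrite expRN => h.
have e0 := expR_gt0 (2^-1 : R).
have : (1 + - 2^-1) * expR (2^-1 : R) <= 1.
  by rewrite -ler_pdivlMr // mul1r.
lra.
Qed.

Lemma jmax_le_ln : jmax%:R <= 2 * ln (T%:R : R).
Proof.
have h : ln ((2 : R) ^+ jmax) <= ln (T%:R : R).
  by rewrite ler_ln ?posrE ?exprn_gt0 ?ltr0n // -natrX ler_nat trunc_logP.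
rewrite lnXn // in h; rewrite -[_ *+ jmax]mulr_natl in h.
have := ler_wpM2l (ler0n R jmax) half_le_ln2; lra.
Qed.

Lemma finite_bound (w1 : 'rV[R]_d) :
  Etraj P K (tgeom R K) nu T
    (fun tr => T%:R^-1 * trajsum (mag_step T gradf) sqgrad (w1, 0) tr) <=
  84 * ((M + L + G) * G * Num.sqrt (tau'%:R / T%:R)) * (1 + ln T%:R + ln tau'%:R).
Proof.
have T0 : 0 < T%:R :> R by rewrite ltr0n.
have M0 : 0 <= M by exact: le_trans (normr_ge0 _) (F_le 0).
have t1 : 1 <= tau'%:R :> R by rewrite ler1n leq_maxl.
have lnt : 0 <= ln (tau'%:R : R) by exact: ln_ge0.
have lnT : 0 <= ln (T%:R : R) by rewrite ln_ge0 // ler1n.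
have G0 : 0 <= G.
  (* [nu] has mass 1, so [Om] is inhabited and [G] bounds some norm. *)
  have [x _] : exists x : Om, True.
    have := nu_prob.2; case: (pickP (fun _ : Om => true)) => [x _ _|e]; first by exists x.
    by rewrite big_pred0 // => /eqP; rewrite eq_sym oner_eq0.
  exact: le_trans (enorm_ge0 _) (grad_le x 0).
set r := Num.sqrt (tau'%:R / T%:R).
have r0 : 0 <= r by exact: sqrtr_ge0.
have rr : r ^+ 2 = tau'%:R / T%:R by rewrite sqr_sqrtr // divr_ge0 ?ltW // (lt_le_trans ltr01).
have Tr : T%:R * r ^+ 2 = tau'%:R by rewrite rr mulrC divfK ?gt_eqF.
have jln := jmax_le_ln; set j := (jmax%:R : R) in jln *.
have j0 : 0 <= j by exact: ler0n.
rewrite EtrajZ ler_pdivrMl //; apply: le_trans (Etraj_sqgrad_le w1) _; rewrite -/j.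
(* The constant 21 comes from [432 <= 441 = 21^2], together with [1 + j <= (1 + j)^2]. *)
have h1 : Num.sqrt (T%:R * (432 * G ^+ 2 * tau'%:R * (1 + j))) <= 21 * T%:R * G * r * (1 + j).
  have X0 : 0 <= 21 * T%:R * G * r * (1 + j) by rewrite !mulr_ge0 ?addr_ge0 ?ler0n.
  rewrite -(ger0_norm X0) -sqrtr_sqr ler_wsqrtr // -Tr.
  have -> : (21 * T%:R * G * r * (1 + j)) ^+ 2 = (T%:R * G * r) ^+ 2 * (441 * (1 + j) ^+ 2) by ring.
  have -> : T%:R * (432 * G ^+ 2 * (T%:R * r ^+ 2) * (1 + j))
    = (T%:R * G * r) ^+ 2 * (432 * (1 + j)) by ring.
  by apply: ler_wpM2l; [exact: sqr_ge0|nra].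
set S := \sum_(k < _) _; set N := (2 : R) ^+ jmax.
have N0 : 0 < N by rewrite exprn_gt0.
have NT : T%:R <= 2 * N.
  by rewrite /N -exprS -natrX ler_nat ltnW // trunc_log_ltn.
have hS1 : S <= 4 * tau'%:R by exact: sum_rho_tau.
have hS2 : S <= 2 * N by rewrite /N -natrX; exact: sum_rho_le2.
(* The bias must become linear in [r]. If [r <= 1], then [S <= 4 tau' = 4 T r^2 <= 8 N r]; otherwise
   the trivial bound gives [S <= 2 N <= 2 N r]. *)
have h2 : N^-1 * (4 * G ^+ 2 * S) <= 32 * G ^+ 2 * r.
  have GG := sqr_ge0 G.
  rewrite ler_pdivrMl //.
  have [r1|r1] := lerP r 1.
    have S2 : S <= 8 * (N * r).
      apply: le_trans hS1 _; rewrite -Tr expr2.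
      have : T%:R * (r * r) <= T%:R * r by rewrite ler_wpM2l ?ler0n // ler_piMl.
      have : T%:R * r <= 2 * N * r by rewrite ler_wpM2r.
      lra.
    have := ler_wpM2l GG S2; lra.
  have S2 : S <= 2 * (N * r).
    apply: le_trans hS2 _; rewrite ler_wpM2l // ler_peMr ?ltW //.
  have := ler_wpM2l GG S2; have : 0 <= G ^+ 2 * (N * r) by rewrite !mulr_ge0 // ltW.
  lra.
have h3 : (2 * M + L) * Num.sqrt (T%:R * (432 * G ^+ 2 * tau'%:R * (1 + j)))
    <= (2 * M + L) * (21 * T%:R * G * r * (1 + j)) by rewrite ler_wpM2l // addr_ge0 ?mulr_ge0.
apply: (le_trans (lerD h3 (ler_wpM2l (ltW T0) h2))).
set X := T%:R * G * r.
have X0 : 0 <= X by rewrite !mulr_ge0 ?ler0n.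
have -> : (2 * M + L) * (21 * T%:R * G * r * (1 + j)) + T%:R * (32 * G ^+ 2 * r)
  = X * ((2 * M + L) * 21 * (1 + j) + 32 * G) by rewrite /X; ring.
have -> : T%:R * (84 * ((M + L + G) * G * r) * (1 + ln T%:R + ln tau'%:R))
  = X * (84 * (M + L + G) * (1 + ln T%:R + ln tau'%:R)) by rewrite /X; ring.
apply: ler_wpM2l => //.
(* The estimate [1 + j <= 2 l] turns the coefficient [21 (2 M + L)] into [84 M + 42 L], which fixes
   the constant 84. *)
set l := 1 + _ + _.
have l1 : 1 <= l by rewrite /l -addrA lerDl addr_ge0.
have jl : 1 + j <= 2 * l by rewrite /l; lra.
have a0 : 0 <= (2 * M + L) * 21 by rewrite mulr_ge0 // addr_ge0 ?mulr_ge0.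
have := ler_wpM2l a0 jl; have := ler_wpM2l G0 l1.
have : 0 <= L * l by rewrite mulr_ge0 //; lra.
have : 0 <= G * l by rewrite mulr_ge0 //; lra.
lra.
Qed.

End FiniteBound.

Local Open Scope classical_set_scope.

(** * Encoding a run of the algorithm as a trajectory *)

Section Trajectories.
Variables (R : realType) (Om : finType).
Implicit Types (js : nat -> nat) (zs : nat -> Om).

(** Blocks are indexed from 0 and iterations from 1, so this is the block of iteration [t + 1]. *)
Definition block js zs t : nat * seq Om :=
  (js t.+1, [seq zs (mag_S js t + i)%N | i <- iota 1 (2 ^ js t.+1)]).

Definition traj_of js zs n : seq (nat * seq Om) := [seq block js zs t | t <- iota 0 n].

Definition samples (tr : seq (nat * seq Om)) : seq Om := flatten (unzip2 tr).

Lemma traj_ofS js zs n : traj_of js zs n.+1 = rcons (traj_of js zs n) (block js zs n).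
Proof. by rewrite /traj_of -addn1 iotaD map_cat cats1. Qed.

Lemma size_traj_of js zs n : size (traj_of js zs n) = n.
Proof. by rewrite size_map size_iota. Qed.

Lemma samples_rcons tr b : samples (rcons tr b) = samples tr ++ b.2.
Proof. by rewrite /samples /unzip2 map_rcons flatten_rcons. Qed.

Lemma mag_S_recr js n : mag_S js n.+1 = (mag_S js n + 2 ^ js n.+1)%N.
Proof. by rewrite /mag_S big_nat_recr. Qed.

Lemma samples_traj_of js zs n :
  samples (traj_of js zs n) = [seq zs i | i <- iota 1 (mag_S js n)].
Proof.
elim: n => [|n IH]; first by rewrite /mag_S big_geq.
rewrite traj_ofS samples_rcons IH mag_S_recr iotaD map_cat; congr (_ ++ _).
by rewrite /= [(1 + _)%N]addnC iotaDl -map_comp.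
Qed.

Variables (d T : nat) (f : Om -> 'rV[R]_d -> R).
Local Notation gradf := (fun x w => grad (f x) w).

Lemma mag_gj_avg js zs t j w : (j <= js t.+1)%N ->
  mag_gj f js zs t.+1 j w = avg (gradf^~ w) j (block js zs t).2.
Proof.
move=> jt; rewrite /mag_gj /avg /= -map_take take_iota.
have /minn_idPl -> : (2 ^ j <= 2 ^ js t.+1)%N by rewrite leq_exp2l.
by rewrite big_map /index_iota subn1.
Qed.

Lemma mag_g_mlmc js zs t w :
  mag_g f T js zs t.+1 w = mlmc T (gradf^~ w) (js t.+1) (block js zs t).2.
Proof.
by rewrite /mag_g /mlmc !mag_gj_avg // leq_pred.
Qed.

Lemma mag_state_foldl w1 js zs n :
  mag_state f T 1 w1 js zs n = foldl (mag_step T gradf) (w1, 0) (traj_of js zs n).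
Proof.
elim: n => [//|n IH]; rewrite traj_ofS foldl_rcons -IH /=.
by case: (mag_state _ _ _ _ _ _ _) => w a; rewrite mag_g_mlmc.
Qed.

Lemma sum_sqgrad mu w1 js zs n :
  trajsum (mag_step T gradf) (sqgrad mu f) (w1, 0) (traj_of js zs n) =
  \sum_(1 <= t < n.+1)
    enorm (grad (fun w => \sum_x mu x * f x w) (mag_iter f T 1 w1 js zs t)) ^+ 2.
Proof.
elim: n => [|n IH]; first by rewrite big_geq.
rewrite traj_ofS trajsum_rcons IH [RHS]big_nat_recr //=; congr (_ + _).
by rewrite enorm_sqr /sqgrad /mag_iter /= mag_state_foldl.
Qed.

End Trajectories.

(** The integral of a nonnegative function is a supremum over simple functions below it, hence
    monotone. In this form it applies to the trajectory functional without a study of its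
    measurability. *)
Lemma ge0_le_integral_nomeas (dsp : measure_display) (X : measurableType dsp) (R : realType)
  (m : {measure set X -> \bar R}) (f g : X -> \bar R) :
  (forall x, 0 <= f x)%E -> (forall x, f x <= g x)%E ->
  (\int[m]_x f x <= \int[m]_x g x)%E.
Proof.
move=> f0 fg; rewrite !ge0_integralTE // => [|x]; last exact: le_trans (fg x).
apply: ereal_sup_le => _ [h hf <-]; exists h => // x.
exact: le_trans (hf x) (fg x).
Qed.

(** * From the probability space to nested finite sums *)

Section Law.
Variables (R : realType) (Om : finType) (P : Om -> Om -> R) (nu : Om -> R).
Hypothesis P_stoch : stochastic P.
Hypothesis nu_prob : prob_distr nu.
Variables (dsp : measure_display) (Wp : measurableType dsp) (Pr : probability Wp R).
Variables (z : nat -> Wp -> Om) (J : nat -> Wp -> nat).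
Hypothesis measurable_z : forall k x, measurable [set w : Wp | z k w = x].
Hypothesis measurable_J : forall t j, measurable [set w : Wp | J t w = j].
Hypothesis joint_law : forall (n m : nat) (xs : nat -> Om) (js : nat -> nat),
  Pr [set w : Wp | (forall i, (i < n)%N -> z i.+1 w = xs i) /\
                   (forall t, (t < m)%N -> J t.+1 w = js t)]
  = ((chain_prob nu P n xs * \prod_(t < m) geom_weight R (js t))%:E)%E.
Variable x0 : Om.
Local Notation traj := (seq (nat * seq Om)).
Implicit Types tr : traj.

(** A cylinder of the joint law; list positions start at 0, samples and levels at 1. *)
Definition cyl tr : set Wp :=
  [set w : Wp | (forall i, (i < size (samples tr))%N -> z i.+1 w = nth x0 (samples tr) i) /\
                (forall t, (t < size tr)%N -> J t.+1 w = nth 0%N (unzip1 tr) t)].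

Lemma measurable_cyl tr : measurable (cyl tr).
Proof.
have -> : cyl tr =
  (\bigcap_(i in `I_(size (samples tr))) [set w : Wp | z i.+1 w = nth x0 (samples tr) i])
  `&` (\bigcap_(t in `I_(size tr)) [set w : Wp | J t.+1 w = nth 0%N (unzip1 tr) t]).
  by [].
by apply: measurableI; apply: fin_bigcap_measurable.
Qed.

Definition trajw tr : R := pathw P nu (samples tr) * \prod_(b <- tr) geom_weight R b.1.

Lemma chain_prob_pathw (s : seq Om) : chain_prob nu P (size s) (nth x0 s) = pathw P nu s.
Proof.
case: s => [//|x s] /=; congr (_ * _); elim: s x => [|y s IH] x; first by rewrite big_ord0.
by rewrite big_ord_recl /= -IH.
Qed.

Lemma prob_cyl tr : Pr (cyl tr) = (trajw tr)%:E.
Proof.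
rewrite joint_law chain_prob_pathw; congr (_ * _)%:E.
rewrite [RHS](big_nth (0%N, [::])) big_mkord; apply: eq_bigr => t _.
by rewrite (nth_map (0%N, [::])).
Qed.

Lemma geom_weight_ge0 j : 0 <= geom_weight R j.
Proof. by rewrite /geom_weight; case: ifP => // _; rewrite invr_ge0 exprn_ge0. Qed.

Lemma trajw_ge0 tr : 0 <= trajw tr.
Proof.
rewrite mulr_ge0 ?pathw_ge0 //; first exact: nu_prob.1.
by apply: prodr_ge0 => b _; exact: geom_weight_ge0.
Qed.

Lemma trajw_rcons tr j s : trajw (rcons tr (j, s)) =
  trajw tr * (geom_weight R j * pathw P (next_law P nu (samples tr)) s).
Proof. by rewrite /trajw samples_rcons pathw_cat big_rcons /=; ring. Qed.

Variables (K : nat) (Phi : traj -> R).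
Hypothesis K_pos : (0 < K)%N.
Hypothesis Phi_ge0 : forall tr, 0 <= Phi tr.

(* Simple function dominating [Phi] of the trajectory on the event
   "it extends [tr] by [n] blocks with levels at most [K]". *)
Fixpoint dom n tr (w : Wp) : R :=
  if n is n'.+1 then
    \sum_(0 <= j < K.+1) \sum_(s : (2 ^ j).-tuple Om) dom n' (rcons tr (j, tval s)) w
  else Phi tr * \1_(cyl tr) w.

Lemma dom_ge0 n tr w : 0 <= dom n tr w.
Proof.
elim: n tr => [|n IH] tr /=; first by rewrite mulr_ge0.
by apply: sumr_ge0 => j _; apply: sumr_ge0.
Qed.

Lemma measurable_dom n tr : measurable_fun setT (dom n tr).
Proof.
elim: n tr => [|n IH] tr /=.
  apply: measurable_funM; first exact: measurable_cst.
  by apply: measurable_indic; exact: measurable_cyl.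
by apply: measurable_sum => j; apply: measurable_sum => s; exact: IH.
Qed.

Lemma integral_sumr (I : Type) (r : seq I) (g : I -> Wp -> R) :
  (forall i, measurable_fun setT (g i)) -> (forall i w, 0 <= g i w) ->
  (\int[Pr]_w (\sum_(i <- r) g i w)%:E = \sum_(i <- r) \int[Pr]_w (g i w)%:E)%E.
Proof.
move=> mg g0; under eq_integral do rewrite -sumEFin.
rewrite ge0_integral_sum // => [i|i w _]; last by rewrite lee_fin.
exact/measurable_EFinP.
Qed.

(** A leaf integrates to [Phi] times the probability of its cylinder, and each further block
    multiplies that probability by its own weight. The loss lies in replacing [geom_weight] by the
    larger [tgeom], which is allowed since [Phi] is nonnegative. *)
Lemma integral_dom_le n tr :
  (\int[Pr]_w (dom n tr w)%:E <=
   (trajw tr * Etraj P K (tgeom R K) (next_law P nu (samples tr)) n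
      (fun t => Phi (tr ++ t)))%:E)%E.
Proof.
elim: n tr => [|n IH] tr /=.
  under eq_integral do rewrite EFinM.
  rewrite ge0_integralZl_EFin //; last first.
    by apply/measurable_EFinP; apply: measurable_indic; exact: measurable_cyl.
  rewrite integral_indic //; last exact: measurable_cyl.
  by rewrite setIT cats0 mulrC EFinM -prob_cyl.
have mdom j : measurable_fun setT (fun w => \sum_(s : (2 ^ j).-tuple Om)
    dom n (rcons tr (j, tval s)) w).
  by apply: measurable_sum => s; exact: measurable_dom.
rewrite integral_sumr //; last first.
  by move=> j w; apply: sumr_ge0 => s _; exact: dom_ge0.
rewrite mulr_sumr -sumEFin !big_nat; apply: lee_sum => j /andP[_ jK].
rewrite integral_sumr => [|s|s w]; [|exact: measurable_dom|exact: dom_ge0].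
rewrite /Epath mulr_sumr mulr_sumr -sumEFin; apply: lee_sum => s _.
apply: (le_trans (IH _)); rewrite lee_fin trajw_rcons samples_rcons /next_law foldl_cat.
rewrite -/(next_law P nu (samples tr)) -/(next_law P _ s).
move: (trajw tr) (trajw_ge0 tr) => c c0; rewrite -!mulrA.
have hq := next_law_prob P_stoch (samples tr) nu_prob.
apply: ler_wpM2l => //.
have -> : (fun t => Phi (tr ++ (j, tval s) :: t)) = (fun t => Phi (rcons tr (j, tval s) ++ t)).
  by apply/funext => t; rewrite cat_rcons.
apply: ler_wpM2r; last exact: geom_weight_le.
rewrite mulr_ge0 ?pathw_ge0 //; first exact: hq.1.
rewrite -[leLHS](Etraj_cst P_stoch (tgeom_sum1 R K_pos) n 0 (next_law_prob P_stoch s hq)).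
apply: Etraj_le => //; [exact: tgeom_ge0|exact: next_law_prob].
Qed.

Local Notation trw w n := (traj_of (J ^~ w) (z ^~ w) n).

Lemma mem_cyl w n : cyl (trw w n) w.
Proof.
split=> [i|t].
  rewrite samples_traj_of size_map size_iota => i_lt.
  by rewrite (nth_map 0%N) ?size_iota // nth_iota.
rewrite size_traj_of /unzip1 -map_comp => t_lt.
by rewrite (nth_map 0%N) ?size_iota // nth_iota.
Qed.

Lemma dom_ge n k w : (forall t, (t < k + n)%N -> (J t.+1 w <= K)%N) ->
  Phi (trw w (k + n)) <= dom n (trw w k) w.
Proof.
elim: n k => [|n IH] k hJ /=.
  by rewrite addn0 indicE mem_set ?mulr1 //; exact: mem_cyl.
have kK : (J k.+1 w <= K)%N by apply: hJ; rewrite addnS ltnS leq_addr.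
have bsize : size (block (J ^~ w) (z ^~ w) k).2 == (2 ^ J k.+1 w)%N.
  by rewrite size_map size_iota.
(* Of the double sum, keep the term of the level and block realised at [w]; the others are
   nonnegative. *)
rewrite big_mkord (bigD1 (Ordinal (kK : (J k.+1 w < K.+1)%N))) //= (bigD1 (Tuple bsize)) //=.
rewrite -[(J k.+1 w, _)]/(block (J ^~ w) (z ^~ w) k) -traj_ofS -addSnnS.
rewrite -addrA ler_wpDr ?IH //; last by rewrite addSnnS.
by rewrite addr_ge0 ?sumr_ge0 // => *; rewrite ?sumr_ge0 // => *; exact: dom_ge0.
Qed.

(** The countable union over [j] reduces measurability to that of the events [J_t = j]. *)
Definition bad n : set Wp := \bigcup_(t in `I_n) \bigcup_(j in [set j | (K < j)%N])
  [set w : Wp | J t.+1 w = j].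

Lemma measurable_bad n : measurable (bad n).
Proof. by apply: bigcup_measurable => t _; apply: bigcup_measurable. Qed.

Lemma integral_traj_le n C : 0 <= C -> (forall w, Phi (trw w n) <= C) ->
  (\int[Pr]_w (Phi (trw w n))%:E <=
   (Etraj P K (tgeom R K) nu n Phi)%:E + C%:E * Pr (bad n))%E.
Proof.
move=> C0 PhiC.
apply: (@le_trans _ _ (\int[Pr]_w ((dom n [::] w)%:E + (C * \1_(bad n) w)%:E))%E).
  apply: ge0_le_integral_nomeas => w; first by rewrite lee_fin.
  rewrite -EFinD lee_fin; have [wb|wb] := pselect (bad n w).
    rewrite [X in _ + _ * X]indicE mem_set // mulr1.
    by rewrite (le_trans (PhiC w)) // lerDr dom_ge0.
  rewrite [X in _ + _ * X]indicE memNset // mulr0 addr0.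
  apply: (@dom_ge n 0) => t tn; rewrite leqNgt; apply/negP => Kt.
  by apply: wb; exists t => //; exists (J t.+1 w).
have mC : measurable_fun setT (fun w => (\1_(bad n) w : R)%:E).
  by apply/measurable_EFinP; apply: measurable_indic; exact: measurable_bad.
have mD : measurable_fun setT (fun w => (dom n [::] w)%:E).
  by apply/measurable_EFinP; exact: measurable_dom.
rewrite ge0_integralD //; last 3 first.
- by move=> w _; rewrite lee_fin dom_ge0.
- by move=> w _; rewrite lee_fin mulr_ge0.
- by apply/measurable_EFinP; apply: measurable_funM => //; apply/measurable_EFinP.
under [X in (_ + X)%E]eq_integral do rewrite EFinM.
rewrite ge0_integralZl_EFin // integral_indic ?setIT //; last exact: measurable_bad.
apply: leeD => //; apply: le_trans (integral_dom_le n [::]) _.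
by rewrite lee_fin /trajw /= big_nil !mul1r.
Qed.

End Law.

(** * Vanishing probability of large levels *)

Section BadEvent.
Variables (R : realType) (dsp : measure_display) (Wp : measurableType dsp).
Variables (Pr : probability Wp R) (J : nat -> Wp -> nat).
Hypothesis measurable_J : forall t j, measurable [set w : Wp | J t w = j].

Lemma bad_cvg0 n : Pr (bad J K n) @[K --> \oo] --> 0%E.
Proof.
have I0 : \bigcap_K bad J K n = set0.
  (* The sum of the first [n] levels is a cutoff that none of them exceeds. *)
  apply/seteqP; split => // w /(_ (\sum_(t < n) J t.+1 w)%N I) [t tn [j /= Kj Jj]].
  by move: Kj; rewrite -Jj ltnNge (bigD1 (Ordinal tn)) //= leq_addr.
rewrite -(measure0 Pr) -I0; apply: nonincreasing_cvg_mu.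
- by rewrite (le_lt_trans (probability_le1 _ _)) ?ltry //; exact: measurable_bad.
- by move=> K; exact: measurable_bad.
- by rewrite I0.
- apply/nonincreasing_seqP => K; apply/subsetPset => w [t tn [j /= Kj Jj]].
  by exists t => //; exists j => //=; exact: ltnW.
Qed.

End BadEvent.

(** * Removal of the cutoff *)

Theorem theorem4p3 :
  exists (c k : nat),
  forall (R : realType) (Om : finType) (P : Om -> Om -> R) (nu mu : Om -> R)
    (tau : nat)
    (dsp : measure_display) (Wp : measurableType dsp) (Pr : probability Wp R)
    (z : nat -> Wp -> Om) (J : nat -> Wp -> nat)
    (d : nat) (f : Om -> 'rV[R]_d -> R) (L M G : R) (T : nat) (w1 : 'rV[R]_d),
    (* Markov chain with transition matrix P, initial law nu, stationary law mu *)
    stochastic P -> ergodic P -> prob_distr nu -> stationary P mu ->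
    is_tau_mix P mu tau ->
    (* (z_k)_{k>=1} is the chain, (J_t)_{t>=1} iid with P(J_t = j) = 2^-j,
       independent of the chain: finite-dimensional joint laws *)
    (forall k x, measurable [set w : Wp | z k w = x]) ->
    (forall t j, measurable [set w : Wp | J t w = j]) ->
    (forall (n m : nat) (xs : nat -> Om) (js : nat -> nat),
       Pr [set w : Wp | (forall i, (i < n)%N -> z i.+1 w = xs i) /\
                   (forall t, (t < m)%N -> J t.+1 w = js t)]
       = ((chain_prob nu P n xs * \prod_(t < m) geom_weight R (js t))%:E)%E) ->
    (* smoothness / boundedness assumptions, F = E_{z ~ mu} f(.; z) *)
    (forall x, forall w : 'rV[R]_d, differentiable (f x) w) ->
    let F := fun w : 'rV[R]_d => \sum_x mu x * f x w in
    (forall w, differentiable F w) ->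
    0 <= L ->
    (forall u v, enorm (grad F u - grad F v) <= L * enorm (u - v)) ->
    (forall w, `|F w| <= M) ->
    (forall x w, enorm (grad (f x) w) <= G) ->
    (1 <= T)%N ->
    let tau' := maxn 1 tau in
    (\int[Pr]_(om in setT)
        ((T%:R)^-1 * \sum_(1 <= t < T.+1)
           enorm (grad F (mag_iter f T 1 w1 (fun t => J t om) (fun k => z k om) t)) ^+ 2)%:E
     <= (c%:R * ((M + L + G) * G * Num.sqrt (tau'%:R / T%:R))
         * (1 + ln (T%:R) + ln (tau'%:R)) ^+ k)%:E)%E.
Proof.
exists 84%N, 1%N => R Om P nu mu tau dsp Wp Pr z J d f L M G T w1.
move=> P_stoch _ nu_prob mu_stat tau_mix mz mJ law f_diff F F_diff L0 F_smooth F_le grad_le T_gt0; cbv zeta.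
have [x0 _] : exists x : Om, True.
  have := nu_prob.2; case: (pickP (fun _ : Om => true)) => [x _ _|e]; first by exists x.
  by rewrite big_pred0 // => /eqP; rewrite eq_sym oner_eq0.
rewrite expr1; set bound := _ * _.
pose Phi (tr : seq (nat * seq Om)) :=
  T%:R^-1 * trajsum (mag_step T (fun x w => grad (f x) w)) (sqgrad mu f) (w1, 0) tr.
have PhiE om : T%:R^-1 * \sum_(1 <= t < T.+1)
    enorm (grad F (mag_iter f T 1 w1 (fun t => J t om) (fun k => z k om) t)) ^+ 2
    = Phi (traj_of (J ^~ om) (z ^~ om) T) by rewrite /Phi sum_sqgrad.
have T0 : 0 < T%:R :> R by rewrite ltr0n.
have Phi0 tr : 0 <= Phi tr.
  by rewrite mulr_ge0 ?invr_ge0 ?ler0n // trajsum_ge0 // => st b; exact: dotvv_ge0.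
(* This pathwise bound is the price paid on the bad event. *)
have PhiC om : Phi (traj_of (J ^~ om) (z ^~ om) T) <= G ^+ 2.
  rewrite -PhiE ler_pdivrMl // (@le_trans _ _ (\sum_(1 <= t < T.+1) G ^+ 2)) //.
    by apply: ler_sum => t _; rewrite enorm_sqr (dot_gradF_le mu_stat f_diff grad_le).
  by rewrite sumr_const_nat subSS subn0 mulr_natl.
under eq_integral do rewrite PhiE.
(* The integral does not depend on [K], so a bound whose excess over [bound] vanishes as [K] grows
   is enough. *)
have cvgK : (bound%:E + (G ^+ 2)%:E * Pr (bad J K T) @[K --> \oo] --> bound%:E)%E.
  rewrite -[X in _ --> X]adde0 -[X in (_ + X)%E](mule0 (G ^+ 2)%:E).
  apply: cvgeD; [by rewrite mule0 fin_num_adde_defl|exact: cvg_cst|].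
  by apply: cvgeZl => //; exact: bad_cvg0.
(* Every [K >= T] is admissible because [K < 2 ^ K]. *)
apply: (cvge_to_ge cvgK); exists T => // K /= TK.
have T_lt : (T < 2 ^ K)%N by rewrite (leq_ltn_trans TK) // ltn_expl.
have K0 : (0 < K)%N by exact: leq_trans T_gt0 TK.
apply: (le_trans (integral_traj_le P_stoch nu_prob mz mJ law x0 K0 Phi0 (sqr_ge0 G) PhiC)).
rewrite leeD2r // lee_fin.
exact: (finite_bound P_stoch nu_prob mu_stat tau_mix f_diff F_diff L0 F_smooth F_le grad_le).
Qed.
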